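(* For every integer $k \geq 1$, every strongly $k$-connected tournament $T$ with $n$ vertices has a strongly $k$-connected spanning subgraph $D$ with at most $kn + 750 k^2 \log_2 (k+1)$ arcs.
   Context: A tournament is an orientation of a complete simple graph (no loops, no multiple arcs). A digraph $D$ is strongly connected if for any two vertices $u,v$ there is a directed path from $u$ to $v$. A digraph $D$ is strongly $k$-connected if $|V(D)| \geq k+1$ and for every set $S \subseteq V(D)$ with $|S| \leq k-1$, the digraph $D - S$ (obtained by deleting the vertices of $S$) is strongly connected. A spanning subgraph of $T$ is a subgraph with vertex set $V(T)$ and arc set a subset of the arcs of $T$. *)

(* Defs.v *)
From mathcomp Require Import all_boot.
From Stdlib Require Import Reals.
Set Implicit Arguments. Unset Strict Implicit. Unset Printing Implicit Defensive.

Definition is_tournament (V : finType) (t : rel V) : Prop :=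
  (forall x, ~~ t x x) /\
  (forall x y, x != y -> (t x y || t y x) && ~~ (t x y && t y x)).

Definition spanning_subgraph (V : finType) (d t : rel V) : Prop :=
  forall x y, d x y -> t x y.

Definition del_rel (V : finType) (d : rel V) (S : {set V}) : rel V :=
  fun x y => [&& d x y, x \notin S & y \notin S].

Definition strongly_connected_minus (V : finType) (d : rel V) (S : {set V}) : Prop :=
  forall u v, u \notin S -> v \notin S -> connect (del_rel d S) u v.

Definition strongly_k_connected (V : finType) (d : rel V) (k : nat) : Prop :=
  k.+1 <= #|V| /\
  forall S : {set V}, #|S| <= k.-1 -> strongly_connected_minus d S.

Definition num_arcs (V : finType) (d : rel V) : nat :=
  #|[set p : V * V | d p.1 p.2]|.

Definition log2R (x : R) : R := (ln x / ln 2)%R.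

(* Main.v *)
Require Import Defs.
From mathcomp Require Import all_boot zify.
From Stdlib Require Import Reals Lra.
Set Implicit Arguments. Unset Strict Implicit. Unset Printing Implicit Defensive.

(* Let [n] be the order of the tournament [t].  A spanning subgraph with
   [k n + O(k^2)] arcs is built when [n] is at least a large multiple of [k]; for
   smaller [n] a cruder construction with [4 k n + O(k^2)] arcs (or all of [t])
   suffices.

   Let [A] and [B] consist of the [k] vertices of least out-degree and of least
   in-degree.  By Menger's theorem there are [k] disjoint paths from [A] to [B],
   which may be taken without shortcuts.  The vertices off the paths, and
   separately those on the paths, are put in a median order; a max-flow min-cut
   argument selects forward arcs so that all but O(k) vertices off (resp. on) the
   paths have [k] (resp. [k - 1]) forward out- and in-neighbours, with only O(k^2)
   arcs more than [k] (resp. [k - 1]) per vertex.  The path arcs supply the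
   missing arc at the vertices on the paths.

   Delete a set [S] of fewer than [k] vertices, and follow out-arcs from a vertex.
   Going forward one ends among the last vertices of an order, or at a vertex [v]
   of a path whose [k - 1] forward out-neighbours are exactly [S]; since the path
   has no shortcut, no vertex of [S] lies on it after [v], so one reaches its end
   in [B].  Each of these O(k) possible exits has large out-degree (the vertices
   of small degree are set aside and handled by Mader's argument on minimal
   [k]-outconnected subgraphs), hence it can be joined by O(k) arcs to [A] so
   robustly that more than half of the paths avoiding [S] are reached at their
   start.  Dually, more than half of the paths avoiding [S] lead from their end to
   any given vertex, so some path serves both purposes. *)

(** * Median orders *)

Definition conv (V : Type) (t : rel V) : rel V := fun x y => t y x.

Lemma tournament_conv (V : finType) (t : rel V) :
  is_tournament t -> is_tournament (conv t).
Proof.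
move=> [ti tt]; split; first exact: ti.
by move=> x y /tt; rewrite /conv; case: (t x y); case: (t y x).
Qed.

Lemma tournamentN (V : finType) (t : rel V) x y :
  is_tournament t -> x != y -> t y x = ~~ t x y.
Proof. by case=> _ tt /tt; case: (t x y); case: (t y x). Qed.

Lemma tournament_neq (V : finType) (t : rel V) x y :
  is_tournament t -> t x y -> x != y.
Proof. by case=> ti _ txy; apply: contraTneq txy => ->; apply: ti. Qed.

Lemma tournament_asym (V : finType) (t : rel V) x y :
  is_tournament t -> t x y -> t y x = false.
Proof.
move=> tt txy; rewrite (tournamentN tt (tournament_neq tt txy)) txy //.
Qed.

Fixpoint fwd (V : Type) (e : rel V) (s : seq V) : nat :=
  if s is x :: r then count (e x) r + fwd e r else 0.

Lemma fwd_cat (V : Type) (e : rel V) s1 s2 :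
  fwd e (s1 ++ s2) = fwd e s1 + fwd e s2 + \sum_(x <- s1) count (e x) s2.
Proof.
elim: s1 => [|x s1 IH] /=; first by rewrite big_nil addn0.
by rewrite big_cons count_cat IH; lia.
Qed.

Lemma fwd_rcons (V : Type) (e : rel V) s x :
  fwd e (rcons s x) = fwd e s + count (conv e x) s.
Proof.
rewrite -cats1 fwd_cat /= !addn0; congr addn.
elim: s => [|y s IH] /=; first by rewrite big_nil.
by rewrite big_cons IH /= addn0.
Qed.

(** Moving [x] across the adjacent block [r] changes only the pairs between [x] and [r]; this is the
    exchange behind the local optimality of median orders. *)
Lemma fwd_move (V : Type) (e : rel V) s1 x r s2 :
  fwd e (s1 ++ x :: r ++ s2) + count (conv e x) r =
  fwd e (s1 ++ r ++ x :: s2) + count (e x) r.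
Proof.
have crossE s : \sum_(y <- s) count (e y) (x :: r ++ s2) =
                \sum_(y <- s) count (e y) (r ++ x :: s2).
  by apply: eq_bigr => y _; rewrite /= !count_cat /=; lia.
rewrite !fwd_cat crossE -[x :: r ++ s2]cat1s -[x :: s2]cat1s !fwd_cat /=.
rewrite !big_cons !big_nil !count_cat addn0.
have -> : \sum_(y <- r) count (e y) (x :: s2) =
          count (conv e x) r + \sum_(y <- r) count (e y) s2.
  elim: r {crossE} => [|y r IH]; first by rewrite !big_nil.
  by rewrite !big_cons IH /= /conv; lia.
lia.
Qed.

Lemma count_conv (V : finType) (t : rel V) x r :
  is_tournament t -> x \notin r -> count (t x) r + count (conv t x) r = size r.
Proof.
move=> tt; elim: r => //= y r IH; rewrite inE negb_or => /andP[xy /IH <-].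
rewrite /conv (tournamentN tt xy); case: (t x y) => /=; lia.
Qed.

(** The local optimality of a median order, up to a slack [c]. The slack is 0 for a tournament and
    becomes 2 once the path arcs are removed. *)
Definition halving (V : Type) (c : nat) (e : rel V) (s : seq V) :=
  forall s1 x r s2,
    (s = s1 ++ x :: r ++ s2 -> size r <= 2 * count (e x) r + c) /\
    (s = s1 ++ r ++ x :: s2 -> size r <= 2 * count (conv e x) r + c).

(** A permutation of [W] with the most forward arcs works: if [x] violated the inequality for an
    interval, moving [x] to its other side would gain forward arcs. *)
Lemma median_order (V : finType) (t : rel V) (W : {set V}) :
  is_tournament t ->
  exists s : seq V, [/\ uniq s, s =i W & halving 0 t s].
Proof.
move=> tt; pose L := permutations (enum W).
pose P n := n \in map (fwd t) L.
have exP : exists n, P n.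
  exists (fwd t (enum W)); apply: map_f; by rewrite mem_permutations.
have ubP n : P n -> n <= \max_(s <- L) fwd t s.
  by case/mapP=> s sL ->; apply: leq_bigmax_seq.
case: (ex_maxnP exP ubP) => m /mapP[s sL ->] smax.
have sp : perm_eq s (enum W) by rewrite -mem_permutations.
have us : uniq s by rewrite (perm_uniq sp) enum_uniq.
have {}smax s' : perm_eq s' s -> fwd t s' <= fwd t s.
  move=> s's; apply: smax; apply: map_f.
  by rewrite mem_permutations (perm_trans s's).
exists s; split=> //; first by move=> x; rewrite (perm_mem sp) mem_enum.
have pm s1 x (r s2 : seq V) : perm_eq (s1 ++ x :: r ++ s2) (s1 ++ r ++ x :: s2).
  by rewrite perm_cat2l -cat1s -[x :: s2]cat1s perm_catCA.
have xNr (s1 : seq V) x r s2 : uniq (s1 ++ x :: r ++ s2) -> x \notin r.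
  by rewrite cat_uniq => /and3P[_ _] /=; rewrite mem_cat negb_or => /andP[/andP[]].
have arith (n a b f g : nat) :
  a + b = n -> f + b = g + a -> g <= f -> n <= 2 * a + 0 by lia.
have arith' (n a b f g : nat) :
  a + b = n -> f + b = g + a -> f <= g -> n <= 2 * b + 0 by lia.
move=> s1 x r s2; split=> sE.
- have:= smax (s1 ++ r ++ x :: s2); rewrite sE perm_sym pm => /(_ isT).
  have:= fwd_move t s1 x r s2; have:= count_conv tt (xNr s1 x r s2 _).
  by rewrite -sE => /(_ us); apply: arith.
- have:= smax (s1 ++ x :: r ++ s2); rewrite sE pm => /(_ isT).
  have:= fwd_move t s1 x r s2; have:= count_conv tt (xNr s1 x r s2 _).
  by rewrite (perm_uniq (pm _ _ _ _)) -sE => /(_ us); apply: arith'.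
Qed.

Lemma tournament_half (V : finType) (t : rel V) (L : {set V}) :
  is_tournament t -> L != set0 ->
  exists2 v, v \in L & #|L| <= 2 * #|[set w in L | t v w]| + 1.
Proof.
move=> tt /set0Pn[v0 v0L]; have [[|x r] [us sL hs]] := median_order L tt.
  by have:= sL v0; rewrite v0L in_nil.
exists x; first by rewrite -sL mem_head.
have [/(_ _) h _] := hs [::] x r [::].
have -> : #|L| = (size r).+1 by rewrite -(eq_card sL) (card_uniqP us).
have -> : #|[set w in L | t x w]| = count (t x) r.
  rewrite -size_filter -(card_uniqP (filter_uniq _ _)); last by case/andP: us.
  apply: eq_card => w; rewrite inE mem_filter -sL inE andbC.
  by case: eqP => [->|] //=; rewrite (negbTE (tt.1 x)).
by move: h; rewrite cats0 => /(_ erefl); lia.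
Qed.

(* Peel off both ends: if the first and the last vertex both lie in [X] and in
   [Y], the halving property gives at least [m - 4] arcs at these two ends. *)
Lemma halving_dense (V : finType) (e : rel V) (X Y : {pred V}) s m :
  halving 2 e s -> size s + m <= count X s + count Y s ->
  m * m <= 4 * fwd [rel x y | [&& x \in X, y \in Y & e x y]] s + 6 * m.
Proof.
move: m; have [n] := ubnP (size s); elim: n s => // n IH s.
rewrite ltnS => ss m hs hm.
have [m6|m6] := leqP m 6; first by have := leq_mul m6 (leqnn m); lia.
have hcons x s' : halving 2 e (x :: s') -> halving 2 e s'.
  move=> h s1 y r s2; have [h1 h2] := h (x :: s1) y r s2.
  by split=> s'E; [apply: h1|apply: h2]; rewrite s'E.
have hrcons x s' : halving 2 e (rcons s' x) -> halving 2 e s'.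
  move=> h s1 y r s2; have [h1 _] := h s1 y r (rcons s2 x).
  have [_ h2] := h s1 y r (rcons s2 x).
  by split=> s'E; [apply: h1|apply: h2]; rewrite s'E rcons_cat /= ?rcons_cat.
case: s => [|x s] in ss hs hm *; first by move: hm => /=; lia.
(* An end vertex outside [X] or outside [Y] is dropped: the size falls by one and the two counts
   together by at most one, so [m] is kept. *)
have [xXY|xNXY] := boolP ((x \in X) && (x \in Y)); last first.
  have /= := IH s _ m (hcons _ _ hs) _.
  move: hm ss => /=; move: xNXY.
  rewrite !unfold_in; case: (X x); case: (Y x) => //= _ hm ss /(_ _ _); lia.
case/lastP: s => [|s y] in ss hs hm *.
  by move: hm => /=; case: (X x); case: (Y x); lia.
have [yXY|yNXY] := boolP ((y \in X) && (y \in Y)); last first.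
  have := IH (x :: s) _ m (hrcons y (x :: s) hs) _.
  rewrite -rcons_cons fwd_rcons.
  move: hm ss => /=; rewrite !size_rcons -!cats1 !count_cat /=; move: yNXY.
  rewrite !unfold_in; case: (X y); case: (Y y) => //= _ hm ss /(_ _ _); lia.
have := IH s _ (m - 2) (hcons x _ (hrcons y (x :: s) hs)) _.
rewrite /= fwd_rcons.
have [h1 _] := hs [::] x s [:: y]; have [_ h2] := hs [:: x] y s [::].
move: hm ss h1 h2; rewrite /= cats1 !size_rcons -!cats1 !count_cat /= ?addn0.
case/andP: xXY yXY => xX xY /andP[yX yY].
move=> hm ss /(_ erefl) h1 /(_ erefl) h2.
(* The out-neighbours of [x] fill about half of [s], so by inclusion and exclusion many of them lie
   in [Y]; [c2] is the dual bound at [y]. *)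
have c1 : count (e x) s + count Y s <=
   size s + count (fun z => [&& x \in X, z \in Y & e x z]) s.
  elim: (s) => //= z r IHr; rewrite xX unfold_in /=.
  move: IHr; rewrite xX /=.
  by case: (Y z); case: (e x z) => /=; lia.
have c2 : count (conv e y) s + count X s <=
   size s + count (conv [rel x y | [&& x \in X, y \in Y & e x y]] y) s.
  elim: (s) => //= z r IHr; rewrite /conv /= yY unfold_in /=.
  move: IHr; rewrite /conv /= yY /=.
  by case: (X z); case: (e z y) => /=; lia.
move: hm; rewrite !(unfold_in _ X, unfold_in _ Y) in xX xY yX yY *.
rewrite xX xY yX yY /= => hm.
have arith (q cX cY a1 a2 d1 d2 f b : nat) :
  q.+2 + m <= 1 + (cX + 1) + (1 + (cY + 1)) ->
  q <= 2 * a1 + 2 -> q <= 2 * a2 + 2 ->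
  a1 + cY <= q + d1 -> a2 + cX <= q + d2 ->
  (m - 2) * (m - 2) <= 4 * f + 6 * (m - 2) ->
  m * m <= 4 * (d1 + b + (f + d2)) + 6 * m.
  have -> : m = (m - 2) + 2 by lia.
  by move: (m - 2) => p; rewrite addnK; lia.
have hm' : size s + (m - 2) <= count X s + count Y s by move: hm; lia.
by move/(_ (ltnW ss) hm'); apply: arith hm h1 h2 c1 c2.
Qed.

(** * Degree-constrained subgraphs *)

Definition outs (V : finType) (D : {set V * V}) x := [set y | (x, y) \in D].
Definition ins (V : finType) (D : {set V * V}) y := [set x | (x, y) \in D].
Definition transp (V : finType) (D : {set V * V}) := [set p | (p.2, p.1) \in D].

Lemma in_transp (V : finType) (D : {set V * V}) x y :
  ((x, y) \in transp D) = ((y, x) \in D).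
Proof. by rewrite inE. Qed.

Lemma transpK (V : finType) : involutive (@transp V).
Proof. by move=> D; apply/setP=> -[x y]; rewrite !in_transp. Qed.

Lemma transp_sub (V : finType) (D1 D2 : {set V * V}) :
  (transp D1 \subset transp D2) = (D1 \subset D2).
Proof.
have imp (A B : {set V * V}) : A \subset B -> transp A \subset transp B.
  by move/subsetP=> AB; apply/subsetP=> -[x y]; rewrite !in_transp => /AB.
by apply/idP/idP=> /imp //; rewrite !transpK.
Qed.

Lemma card_transp (V : finType) (D : {set V * V}) : #|transp D| = #|D|.
Proof.
pose sw (p : V * V) := (p.2, p.1).
have swI : injective sw by case=> [a b] [c d] [-> ->].
have le (A : {set V * V}) : #|transp A| <= #|A|.
  rewrite -(card_imset A swI); apply: subset_leq_card.
  by apply/subsetP=> -[x y]; rewrite in_transp => /(imset_f sw).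
by apply/eqP; rewrite eqn_leq le -{1}[D]transpK le.
Qed.

Lemma outs_transp (V : finType) (D : {set V * V}) x : outs (transp D) x = ins D x.
Proof. by apply/setP=> y; rewrite !inE. Qed.

Lemma minset_transp (V : finType) (P Q : pred {set V * V}) D :
  (forall D', P (transp D') = Q D') -> minset Q D -> minset P (transp D).
Proof.
move=> PQ /minsetP[QD minD]; apply/minsetP; split=> [|B PB BD]; first by rewrite PQ.
have := minD (transp B); rewrite -PQ transpK -transp_sub transpK.
by move=> /(_ PB BD) <-; rewrite transpK.
Qed.

Lemma minset_del (T : finType) (P : pred {set T}) D p :
  minset P D -> p \in D -> ~~ P (D :\ p).
Proof.
case/minsetP=> _ minD pD; apply: contraL pD => /minD <-; last exact: subD1set.
by rewrite !inE eqxx.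
Qed.

Lemma card_set_in (T : finType) (D : {set T}) (P : pred T) :
  #|[set p in D | P p]| = \sum_(p in D) P p.
Proof.
rewrite -sum1dep_card big_mkcondr /=; apply: eq_bigr => p _; by case: (P p).
Qed.

Lemma card_set_sum (T : finType) (A : {set T}) : #|A| = \sum_p (p \in A).
Proof. by rewrite -sum1_card big_mkcond; apply: eq_bigr => p _; case: (p \in A). Qed.

Lemma card_outs_sum (V : finType) (D : {set V * V}) :
  \sum_x #|outs D x| = #|D|.
Proof.
transitivity (\sum_x \sum_y ((x, y) \in D)).
  by apply: eq_bigr => x _; rewrite card_set_sum; apply: eq_bigr => y _; rewrite inE.
by rewrite pair_bigA card_set_sum; apply: eq_bigr => -[].
Qed.

Definition rect (V : finType) (D : {set V * V}) (X Y : {set V}) :=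
  [set p in D | (p.1 \in X) && (p.2 \in Y)].

Lemma rect_uncross (V : finType) (D : {set V * V}) (X1 Y1 X2 Y2 : {set V}) :
  #|rect D (X1 :&: X2) (Y1 :|: Y2)| + #|rect D (X1 :|: X2) (Y1 :&: Y2)|
  <= #|rect D X1 Y1| + #|rect D X2 Y2|.
Proof.
rewrite !card_set_in -!big_split; apply: leq_sum => p _ /=; rewrite !inE.
by case: (p.1 \in X1); case: (p.1 \in X2); case: (p.2 \in Y1); case: (p.2 \in Y2).
Qed.

(* By max-flow min-cut, the largest [D \subset F] with all degrees at most [k]
   has at least [m] arcs iff [cut_ge k W m F]. *)
Definition cut (V : finType) k (W : {set V}) (D : {set V * V}) (X Y : {set V}) :=
  #|rect D X Y| + k * #|W :\: X| + k * #|W :\: Y|.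

Definition cut_ge (V : finType) k (W : {set V}) m (D : {set V * V}) :=
  [forall X : {set V}, forall Y : {set V}, m <= cut k W D X Y].

Lemma cut_uncross (V : finType) k W (D : {set V * V}) (X1 Y1 X2 Y2 : {set V}) :
  cut k W D (X1 :&: X2) (Y1 :|: Y2) + cut k W D (X1 :|: X2) (Y1 :&: Y2)
  <= cut k W D X1 Y1 + cut k W D X2 Y2.
Proof.
have := rect_uncross D X1 Y1 X2 Y2; rewrite /cut.
have modular (A B : {set V}) :
    #|W :\: (A :&: B)| + #|W :\: (A :|: B)| = #|W :\: A| + #|W :\: B|.
  by rewrite setDIr setDUr cardsUI.
have := modular X1 X2; have := modular Y1 Y2.
move: #|W :\: (X1 :&: X2)| #|W :\: (X1 :|: X2)| #|W :\: X1| #|W :\: X2|.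
move: #|W :\: (Y1 :&: Y2)| #|W :\: (Y1 :|: Y2)| #|W :\: Y1| #|W :\: Y2|.
move=> a b c d a' b' c' d' e1 e2 h.
have := congr1 (muln k) e1; have := congr1 (muln k) e2; rewrite !mulnDr; lia.
Qed.

Lemma cut_ge_transp (V : finType) k W m (D : {set V * V}) :
  cut_ge k W m (transp D) = cut_ge k W m D.
Proof.
have rectE (A : {set V * V}) X Y : #|rect (transp A) X Y| = #|rect A Y X|.
  rewrite -card_transp; apply: eq_card => -[x y].
  by rewrite !inE /= [(x \in Y) && _]andbC.
have cutE X Y : cut k W (transp D) X Y = cut k W D Y X.
  by rewrite /cut rectE addnAC.
by apply/forallP/forallP=> h X; apply/forallP=> Y;
   have /forallP/(_ X) := h Y; rewrite cutE.
Qed.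

(** Each arc out of [x] is critical for a tight pair [(X, Y)] with [x] in [X] and its head in [Y].
    Uncrossing keeps tightness, so a tight pair with [Y] largest contains all heads. *)
Lemma minimal_cut_outs (V : finType) k W m (D : {set V * V}) x :
  minset (cut_ge k W m) D -> x \in W -> #|outs D x| <= k.
Proof.
move=> minD xW; have /minsetP[/forallP cutD _] := minD.
have {}cutD X Y : m <= cut k W D X Y by have /forallP := cutD X; apply.
pose T (p : {set V} * {set V}) := (x \in p.1) && (cut k W D p.1 p.2 == m).
have crit y : y \in outs D x -> exists2 p, T p & y \in p.2.
  rewrite inE => xyD.
  have [X [Y lt]] : exists X Y : {set V}, cut k W (D :\ (x, y)) X Y < m.
    have := minset_del minD xyD; rewrite negb_forall => /existsP[X].
    by rewrite negb_forall => /existsP[Y]; rewrite -ltnNge; exists X, Y.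
  have := cutD X Y; move: lt; rewrite /cut.
  have -> : rect (D :\ (x, y)) X Y = rect D X Y :\ (x, y).
    by apply/setP=> p; rewrite !inE -andbA.
  rewrite (cardsD1 (x, y) (rect D X Y)) !inE xyD /=.
  have [/andP[xX yY]|_] := boolP ((x \in X) && (y \in Y)); last first.
    by move: #|_ :\ _| (k * _) (k * _) => a b c /=; lia.
  move=> lt le; exists (X, Y) => //; move: lt le.
  rewrite /T /cut (cardsD1 (x, y) (rect D X Y)) !inE xyD /= xX yY.
  by move: #|_ :\ _| (k * _) (k * _) => a b c /= lt le; apply/eqP; lia.
have [->|/set0Pn[y0 /crit[p0 Tp0 _]]] := eqVneq (outs D x) set0.
  by rewrite cards0.
case: (arg_maxnP (fun p : {set V} * {set V} => #|p.2|) Tp0) => -[X Y] /=.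
case/andP=> /= xX /eqP tight maxY.
have sub : outs D x \subset Y.
  apply/subsetP=> y /crit[[X' Y'] /andP[/= xX' /eqP tight'] yY'].
  have tightU : T (X :&: X', Y :|: Y').
    rewrite /T /= inE xX xX' /=; have := cut_uncross k W D X Y X' Y'.
    have := cutD (X :&: X') (Y :|: Y'); have := cutD (X :|: X') (Y :&: Y').
    by rewrite tight tight'; lia.
  have := maxY _ tightU; rewrite /= => le.
  have /eqP -> : Y == Y :|: Y' by rewrite eqEcard subsetUl.
  by rewrite inE yY' orbT.
(* Removing [x] from [X] saves all out-arcs of [x] and costs [k]; as the cut was tight, there are at
   most [k] of them. *)
have := cutD (X :\ x) Y; rewrite -{1}tight /cut.
have -> : #|W :\: (X :\ x)| = #|W :\: X|.+1.
  rewrite (cardsD1 x) !inE eqxx xW /= add1n; congr _.+1.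
  by apply: eq_card => z; rewrite !inE; case: eqP => [->|]; rewrite ?xX.
have <- : #|rect D (X :\ x) Y| + #|outs D x| = #|rect D X Y|.
  rewrite -(cardsID [set p | p.1 == x] (rect D X Y)) addnC; congr addn.
    rewrite -(card_imset (outs D x) (f := pair x)); last by move=> ? ? [].
    apply: eq_card => -[u v]; rewrite !inE /=.
    apply/imsetP/andP=> [[w wo [-> ->]]|[/and3P[uvD uX vY] /eqP ux]].
      by move: (wo); rewrite inE xX (subsetP sub _ wo) eqxx => ->.
    by exists v; rewrite -?ux ?inE.
  by apply: eq_card => -[u v]; rewrite !inE /=; case: (u == x); rewrite ?andbF.
by rewrite mulnS; lia.
Qed.

(** An inclusion-minimal arc set with the cut property has small degrees, on the in-side by
    transposition; the cut [X = Y = setT] counts its arcs. *)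
Lemma b_matching (V : finType) k (W : {set V}) m (F : {set V * V}) :
  cut_ge k W m F ->
  exists D : {set V * V},
    [/\ D \subset F, forall x, x \in W -> #|outs D x| <= k,
        forall x, x \in W -> #|ins D x| <= k & m <= #|D|].
Proof.
case/minset_exists=> D minD DF; exists D; split=> // [x|x|].
- exact: minimal_cut_outs minD.
- move=> xW; rewrite -outs_transp; apply: minimal_cut_outs xW.
  by apply: minset_transp minD => D'; apply: cut_ge_transp.
have /minsetP[/forallP/(_ setT)/forallP/(_ setT) + _] := minD.
rewrite /cut !setDT !cards0 !muln0 !addn0 => /leq_trans-> //.
by apply: subset_leq_card; apply/subsetP=> p; rewrite inE => /andP[].
Qed.

(** * Sparse forward arcs along a median order *)

Lemma set_between (T : finType) (A B : {set T}) k :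
  A \subset B -> #|A| <= k -> k <= #|B| ->
  exists E : {set T}, [/\ A \subset E, E \subset B & #|E| = k].
Proof.
move=> AB; elim: k => [|k IH] Ak kB.
  by exists A; split=> //; apply/eqP; rewrite -leqn0.
move: Ak; rewrite leq_eqVlt => /predU1P[Ak|Ak]; first by exists A.
have [E [AE EB Ek]] := IH Ak (ltnW kB).
have /set0Pn[x] : B :\: E != set0.
  by rewrite -card_gt0 cardsD (setIidPr EB) Ek subn_gt0.
rewrite !inE => /andP[xE xB]; exists (x |: E); split.
- by rewrite (subset_trans AE) ?subsetUr.
- by rewrite subUset sub1set xB.
- by rewrite cardsU1 xE Ek.
Qed.

(** Every vertex of [W] with enough out-neighbours in [F] receives just the [k - #|outs D x|] arcs
    it lacks, so old and new arcs together number at most [k] per vertex. *)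
Lemma fill_outs (V : finType) (F D : {set V * V}) (W : {set V}) k :
  D \subset F -> (forall x y, (x, y) \in D -> x \in W) ->
  (forall x, x \in W -> #|outs D x| <= k) ->
  exists E : {set V * V},
    [/\ E \subset F, #|E| + #|D| <= k * #|W| &
        forall x, x \in W -> k <= #|outs F x| -> k <= #|outs (D :|: E) x|].
Proof.
move=> DF DW Dk.
have DFo x : outs D x \subset outs F x.
  by apply/subsetP=> y; rewrite !inE => /(subsetP DF).
have ex x : exists E : {set V}, (x \in W) && (k <= #|outs F x|) ->
    [/\ outs D x \subset E, E \subset outs F x & #|E| = k].
  have [/andP[xW kF]|] := boolP ((x \in W) && _); last by exists set0.
  by have [E hE] := set_between (DFo x) (Dk x xW) kF; exists E.
have [f fP] := fin_all_exists ex.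
pose E := [set q : V * V | [&& q.1 \in W, k <= #|outs F q.1| & q.2 \in f q.1 :\: outs D q.1]].
have EoE x : outs E x \subset f x :\: outs D x.
  by apply/subsetP=> y; rewrite !inE /= => /and3P[].
exists E; split.
- apply/subsetP=> -[x y]; rewrite !inE /= => /and4P[xW kF _ yf].
  have [|_ /subsetP/(_ y yf)] := fP x; first by rewrite xW.
  by rewrite inE.
- rewrite -!card_outs_sum -big_split /= mulnC -sum_nat_const [X in _ <= X]big_mkcond.
  apply: leq_sum => x _; case: ifP => xW; last first.
    rewrite leqn0 addn_eq0 !cards_eq0; apply/andP; split; apply/eqP/setP=> y.
      by rewrite !inE /= xW.
    by rewrite !inE; apply: contraFF xW => /DW.
  have [kF|kF] := leqP k #|outs F x|; last first.
    have -> : outs E x = set0.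
      by apply/setP=> y; rewrite !inE /= leqNgt kF andbF.
    by rewrite cards0 add0n Dk.
  have [|Df _ fk] := fP x; first by rewrite xW.
  have := subset_leq_card (EoE x); rewrite cardsD (setIidPr Df) fk.
  by have := Dk x xW; lia.
- move=> x xW kF; have [|Df fF fk] := fP x; first by rewrite xW.
  rewrite -fk; apply: subset_leq_card; apply/subsetP=> y yf.
  by rewrite !inE /= xW kF yf; case: ((x, y) \in D).
Qed.

Definition fwd_set (V : finType) (e : rel V) (s : seq V) : {set V * V} :=
  [set q | [&& q.1 \in s, q.2 \in s, e q.1 q.2 & index q.1 s < index q.2 s]].

Lemma count_card (V : finType) (P : pred V) (s : seq V) :
  uniq s -> count P s = #|[set y in s | P y]|.
Proof.
move=> us; rewrite -size_filter -(card_uniqP (filter_uniq P us)).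
by apply: eq_card => y; rewrite inE mem_filter andbC.
Qed.

Lemma card_fwd_set (V : finType) (e : rel V) (s : seq V) :
  uniq s -> #|fwd_set e s| = fwd e s.
Proof.
elim: s => [_|x r IH /= /andP[xr ur]].
  by apply/eqP; rewrite cards_eq0 -subset0; apply/subsetP=> q; rewrite !inE.
rewrite -IH // (count_card _ ur).
rewrite -(card_imset [set y in r | e x y] (f := pair x)); last by move=> ? ? [].
set A := pair x @: _.
rewrite -[LHS](cardsID A); congr addn.
  apply: eq_card => -[u v]; rewrite !inE /=; apply/andP/idP => [[]|h] //.
  split=> //; case/imsetP: h => y; rewrite inE => /andP[yr exy] [-> ->].
  rewrite eqxx /= yr exy orbT /=.
  by have := memPn xr _ yr; rewrite eq_sym; case: eqP.
apply: eq_card => -[u v]; rewrite !inE /=.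
have [uEx|ux] := eqVneq u x; last first.
  have -> : ((u, v) \in A) = false.
    by apply/imsetP=> -[y _ [uE _]]; rewrite uE eqxx in ux.
  have [vEx|vx] := eqVneq v x; first by rewrite vEx (negbTE xr) ?eqxx ?ltn0 ?andbF.
  by rewrite /= ?ltnS.
subst u; rewrite (negbTE xr) /=.
apply/negbTE/negP; have [_|vx] := eqVneq v x; first by rewrite !andbF.
case/and4P=> /negP nA /= vr exv _; apply: nA.
by apply/imsetP; exists v; rewrite // inE vr.
Qed.

Lemma count_le1 (V : finType) (P : pred V) (s : seq V) :
  uniq s -> (forall y z, P y -> P z -> y = z) -> count P s <= 1.
Proof.
move=> us P1; rewrite count_card //; apply/card_le1_eqP=> y z.
by rewrite !inE => /andP[_ Py] /andP[_ Pz]; apply: P1.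
Qed.

(** As [p] has at most one arc into and one out of each vertex, every count drops by at most one,
    which the slack 2 absorbs. *)
Lemma halving_diff (V : finType) (t p : rel V) (s : seq V) :
  uniq s -> (forall x y z, p x y -> p x z -> y = z) ->
  (forall x y z, p y x -> p z x -> y = z) ->
  halving 0 t s -> halving 2 [rel x y | t x y && ~~ p x y] s.
Proof.
move=> us pout pin hs s1 x r s2.
have le (P Q : pred V) : count P r <= count [pred y | P y && ~~ Q y] r + count Q r.
  rewrite -count_predUI (leq_trans _ (leq_addr _ _)) //; apply: sub_count => y /=.
  by case: (P y); case: (Q y).
have ur s' s'' : s = s' ++ r ++ s'' -> uniq r.
  by move=> sE; move: us; rewrite sE !cat_uniq => /and4P[_ _ ->].
have arith (n a b c : nat) : n <= 2 * a + 0 -> a <= b + c -> c <= 1 -> n <= 2 * b + 2.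
  by lia.
have [h1 h2] := hs s1 x r s2; split=> sE.
- have {}ur : uniq r by apply: (ur (rcons s1 x) s2); rewrite sE cat_rcons.
  exact: arith (h1 sE) (le (t x) (p x)) (count_le1 ur (pout x)).
- have {}ur : uniq r by apply: (ur s1 (x :: s2)).
  exact: arith (h2 sE) (le (conv t x) (conv p x)) (count_le1 ur (pin x)).
Qed.

(** The halving property is applied to everything after [x]: fewer than [k] forward out-neighbours
    leave at most [2 * (k - 1) + 2] vertices there, and [x] itself adds one. *)
Lemma fwd_set_outs (V : finType) (e : rel V) (s : seq V) x k :
  uniq s -> halving 2 e s -> x \in s -> #|outs (fwd_set e s) x| < k ->
  size s - index x s <= 2 * k + 1.
Proof.
move=> us hs xs; set i := index x s => lt.
have sE : s = take i s ++ x :: drop i.+1 s ++ [::].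
  rewrite cats0 -{1}[s](cat_take_drop i); congr cat.
  by rewrite (drop_nth x) ?index_mem // nth_index.
have [/(_ sE) h _] := hs (take i s) x (drop i.+1 s) [::].
have ud : uniq (drop i.+1 s) by rewrite drop_uniq.
have sub : [set y in drop i.+1 s | e x y] \subset outs (fwd_set e s) x.
  apply/subsetP=> y; rewrite !inE /= => /andP[yd exy].
  rewrite xs (mem_drop yd) exy /= ltnNge -ltnS -(in_take _ (mem_drop yd)).
  apply/negP=> yt; move: us; rewrite -(cat_take_drop i.+1 s) cat_uniq.
  by case/and3P=> _ /hasP[]; exists y.
have := subset_leq_card sub; rewrite -(count_card _ ud).
move: h; rewrite size_drop; move: (count _ _) (size s) lt => a b; lia.
Qed.

Lemma fwd_set_ins (V : finType) (e : rel V) (s : seq V) x k :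
  uniq s -> halving 2 e s -> x \in s -> #|ins (fwd_set e s) x| < k ->
  index x s <= 2 * k.
Proof.
move=> us hs xs; set i := index x s => lt.
have sE : s = [::] ++ take i s ++ x :: drop i.+1 s.
  rewrite cat0s -{1}[s](cat_take_drop i); congr cat.
  by rewrite (drop_nth x) ?index_mem // nth_index.
have [_ /(_ sE) h] := hs [::] x (take i s) (drop i.+1 s).
have ut : uniq (take i s) by rewrite take_uniq.
have sub : [set y in take i s | conv e x y] \subset ins (fwd_set e s) x.
  apply/subsetP=> y; rewrite !inE /conv /= => /andP[yt eyx].
  have ys := mem_take yt.
  by rewrite xs ys eyx /= -(in_take _ ys).
have := subset_leq_card sub; rewrite -(count_card _ ut).
have : i <= size s by rewrite index_size.
by move: h; rewrite size_take_min; move: (count _ _) lt => a; lia.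
Qed.

Lemma card_index_lt (V : finType) (s : seq V) n :
  #|[set x in s | index x s < n]| <= n.
Proof.
have sub : {subset [set x in s | index x s < n] <= take n s}.
  by move=> x; rewrite inE => /andP[xs]; rewrite -in_take.
have /(leq_trans (card_size _)) : size (take n s) <= n by rewrite size_take_min geq_minl.
by apply: leq_trans; apply: subset_leq_card; apply/subsetP.
Qed.

Lemma card_index_ge (V : finType) (s : seq V) n :
  uniq s -> #|[set x in s | size s - index x s <= n]| <= n.
Proof.
move=> us.
have sub : {subset [set x in s | size s - index x s <= n] <= drop (size s - n) s}.
  move=> x; rewrite inE => /andP[xs h].
  have : x \in take (size s - n) s ++ drop (size s - n) s by rewrite cat_take_drop.
  by rewrite mem_cat in_take // => /orP[|//]; lia.
have /(leq_trans (card_size _)) : size (drop (size s - n) s) <= n.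
  by rewrite size_drop; lia.
by apply: leq_trans; apply: subset_leq_card; apply/subsetP.
Qed.

Lemma fwd_set_cut (V : finType) (e : rel V) (s : seq V) (W : {set V}) k :
  uniq s -> s =i W -> halving 2 e s ->
  cut_ge k W (k * #|W| - (k + 2) * (k + 2)) (fwd_set e s).
Proof.
move=> us sW hs; apply/forallP=> X; apply/forallP=> Y; rewrite /cut.
have sizeE : size s = #|W| by rewrite -(card_uniqP us) (eq_card sW).
have cE (Z : {set V}) : #|W :\: Z| + count (mem Z) s = #|W|.
  rewrite count_card // -(cardsID Z W) addnC; congr addn.
  by apply: eq_card => x; rewrite !inE sW.
have f_le : fwd [rel x y | [&& x \in X, y \in Y & e x y]] s <=
            #|rect (fwd_set e s) X Y|.
  rewrite -card_fwd_set //; apply: subset_leq_card; apply/subsetP=> q.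
  by rewrite !inE /= => /and4P[-> -> /and3P[-> -> ->] ->].
have := @halving_dense _ e (mem X) (mem Y) s (count (mem X) s + count (mem Y) s - size s) hs.
move: f_le; rewrite sizeE; have := cE X; have := cE Y.
move: (fwd _ s) #|rect _ _ _| #|_ :\: X| #|_ :\: Y| (count _ s) (count _ s) #|W|.
move=> f r a b c d n ac bd fr h.
have [le|lt] := leqP (c + d) n.
  have : k * n <= k * a + k * b by rewrite -mulnDr leq_mul2l; apply/orP; right; lia.
  by move: (k * n) (k * a) (k * b) ((k + 2) * (k + 2)); lia.
have {h} := h _; rewrite subnKC; last exact: ltnW.
move/(_ (leqnn _)); have e1 : n = a + b + (c + d - n) by lia.
(* It remains to see that [k * m <= r + (k + 2) * (k + 2)], given [m * m <= 4 * r + 6 * m];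
   completing the square at [2 * k + 3] does it. *)
move: (c + d - n) e1 => m -> h; have := leq_of_leqif (nat_Cauchy m (2 * k + 3)).
by rewrite leq_subLR -(mulnn m) -(mulnn (2 * k + 3)); lia.
Qed.

(** A near-regular forward subgraph with [d] arcs is topped up separately on the out-side and on the
    in-side. Each top-up costs at most [k * #|W| - d], so the total is at most [2 * k * #|W| - d],
    and [d] falls short of [k * #|W|] by at most [(k + 2) * (k + 2)]. The exceptional sets lie at
    the two ends of the order. *)
Lemma sparse_forward (V : finType) (t p : rel V) (W : {set V}) k :
  is_tournament t ->
  (forall x y z, p x y -> p x z -> y = z) ->
  (forall x y z, p y x -> p z x -> y = z) ->
  exists (D : {set V * V}) (rk : V -> nat) (Q Q' : {set V}),
    [/\ forall x y, (x, y) \in D ->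
          [/\ t x y, ~~ p x y, x \in W, y \in W & rk x < rk y],
        #|D| <= k * #|W| + (k + 2) * (k + 2),
        [/\ Q \subset W, #|Q| <= 2 * k + 1 &
            forall x, x \in W -> x \notin Q -> k <= #|outs D x|] &
        [/\ Q' \subset W, #|Q'| <= 2 * k + 1 &
            forall x, x \in W -> x \notin Q' -> k <= #|ins D x|]].
Proof.
move=> tt pout pin; have [s [us sW hs]] := median_order W tt.
have {}hs := halving_diff us pout pin hs.
set e := [rel x y | _] in hs; pose F := fwd_set e s.
have [D [DF Do Di Dm]] := b_matching (fwd_set_cut k us sW hs).
have FP x y : (x, y) \in F -> [/\ t x y, ~~ p x y, x \in W, y \in W & index x s < index y s].
  by rewrite inE /= !sW => /and4P[-> -> /andP[-> ->] ->].
have DW x y : (x, y) \in D -> x \in W by move/(subsetP DF)/FP=> [].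
have DW' x y : (x, y) \in transp D -> x \in W by rewrite inE => /(subsetP DF)/FP[].
have [E [EF Ec Eo]] := fill_outs DF DW Do.
have Di' x : x \in W -> #|outs (transp D) x| <= k by rewrite outs_transp; apply: Di.
have DF' : transp D \subset transp F by rewrite transp_sub.
have [E' [EF' Ec' Eo']] := fill_outs DF' DW' Di'.
exists (D :|: E :|: transp E'), (index^~ s).
exists [set x in W | #|outs F x| < k], [set x in W | #|ins F x| < k]; split.
- move=> x y; rewrite !inE => h; apply: FP; case/orP: h => [/orP[]|].
  + exact: (subsetP DF).
  + exact: (subsetP EF).
  + by move/(subsetP EF'); rewrite in_transp.
- have := leq_card_setU (D :|: E) (transp E'); have := leq_card_setU D E.
  rewrite card_transp; move: Ec Ec' Dm; rewrite card_transp.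
  move=> h1 h2 h3 [h4 _] [h5 _]; move: h1 h2 h3 h4 h5.
  by move: #|_| #|_| #|_| #|_| #|_| (k * _) ((k + 2) * (k + 2)); lia.
- split; first by apply/subsetP=> x; rewrite inE => /andP[].
    apply: leq_trans (leq_trans (subset_leq_card _) (card_index_ge (2 * k + 1) us)) _ => //.
    by apply/subsetP=> x; rewrite !inE -sW => /andP[xs /(fwd_set_outs us hs xs) ->]; rewrite xs.
  move=> x xW; rewrite inE xW /= -leqNgt => /(Eo x xW) /leq_trans-> //.
  by apply: subset_leq_card; apply/subsetP=> y; rewrite !inE => ->.
- split; first by apply/subsetP=> x; rewrite inE => /andP[].
    apply: leq_trans (leq_trans (subset_leq_card _) (card_index_lt s (2 * k).+1)) _; last by lia.
    by apply/subsetP=> x; rewrite !inE -sW ltnS => /andP[xs /(fwd_set_ins us hs xs) ->]; rewrite xs.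
  move=> x xW; rewrite inE xW /= -leqNgt => xF.
  have := Eo' x xW; rewrite outs_transp => /(_ xF) /leq_trans-> //.
  apply: subset_leq_card; apply/subsetP=> y; rewrite !inE => /orP[] ->; by rewrite ?orbT.
Qed.

(** * Sparse escape from a set of vertices *)

Definition nbr (V : finType) (D : {set V * V}) (X : {set V}) :=
  [set y | (y \notin X) && [exists x in X, (x, y) \in D]].

Lemma nbr_uncross (V : finType) (D : {set V * V}) (X Y : {set V}) :
  #|nbr D (X :&: Y)| + #|nbr D (X :|: Y)| <= #|nbr D X| + #|nbr D Y|.
Proof.
rewrite !card_set_sum -!big_split; apply: leq_sum => y _ /=; rewrite !inE.
have -> : [exists x in X :|: Y, (x, y) \in D] =
          [exists x in X, (x, y) \in D] || [exists x in Y, (x, y) \in D].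
  apply/exists_inP/orP=> [[x]|[]/exists_inP[x xX xy]].
  - by rewrite inE => /orP[] h xy; [left|right]; apply/exists_inP; exists x.
  - by exists x => //; rewrite inE xX.
  - by exists x => //; rewrite inE xX orbT.
have : [exists x in X :&: Y, (x, y) \in D] ==>
       [exists x in X, (x, y) \in D] && [exists x in Y, (x, y) \in D].
  apply/implyP=> /exists_inP[x]; rewrite inE => /andP[xX xY] xy.
  by apply/andP; split; apply/exists_inP; exists x.
case: (y \in X); case: (y \in Y); case: [exists x in X :&: Y, _] => //=;
  by do 2!case: [exists x in _, _].
Qed.

(** Mader's argument: in a minimal [M] every arc leaves a tight set, one with exactly [k]
    neighbours. Tight sets through [x] are closed under intersection, so the smallest one contains
    no out-neighbour of [x]; all of these are thus among its [k] neighbours. Arcs start in [C],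
    whence [k * #|C|]. *)
Lemma sparse_escape (V : finType) (F : {set V * V}) (C : {set V}) k :
  (forall X : {set V}, X \subset C -> X != set0 -> k <= #|nbr F X|) ->
  exists M : {set V * V},
    [/\ M \subset F, #|M| <= k * #|C| &
        forall X : {set V}, X \subset C -> X != set0 -> k <= #|nbr M X|].
Proof.
move=> escF.
pose P (M : {set V * V}) :=
  [forall X : {set V}, (X \subset C) && (X != set0) ==> (k <= #|nbr M X|)].
have PF : P F by apply/forall_inP=> X /andP[]; apply: escF.
have [M minM MF] := minset_exists PF.
have /minsetP[/forall_inP escM _] := minM.
exists M; split=> // [|X XC X0]; last by apply: escM; rewrite XC.
have crit x y : (x, y) \in M -> exists X : {set V},
    [/\ X \subset C, x \in X, y \notin X & #|nbr M X| = k].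
  move=> xyM; have /forall_inPn[X /andP[XC X0]] := minset_del minM xyM.
  rewrite -ltnNge => lt; exists X; have le : k <= #|nbr M X| by apply: escM; rewrite XC.
  have sub : nbr M X :\ y \subset nbr (M :\ (x, y)) X.
    apply/subsetP=> z; rewrite !inE => /and3P[zy -> /exists_inP[u uX uz]].
    by apply/exists_inP; exists u; rewrite // !inE uz xpair_eqE (negbTE zy) andbF.
  have same : ~~ ((x \in X) && (y \notin X)) -> nbr (M :\ (x, y)) X = nbr M X.
    move=> xyX; apply/setP=> z; rewrite !inE; apply/andb_id2l => zX.
    apply/exists_inP/exists_inP=> -[u uX uz]; exists u => //.
      by move: uz; rewrite inE => /andP[].
    rewrite !inE uz andbT xpair_eqE; apply: contra xyX => /andP[/eqP <- /eqP <-].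
    by rewrite uX.
  have [/andP[xX yX]|/same e] := boolP ((x \in X) && (y \notin X)); last first.
    by move: lt; rewrite e ltnNge le.
  split=> //; apply/eqP; rewrite eqn_leq le andbT.
  have := leq_ltn_trans (subset_leq_card sub) lt; rewrite (cardsD1 y (nbr M X)).
  by case: (y \in _); rewrite ?add0n ?add1n // => /ltnW.
rewrite -card_outs_sum mulnC -sum_nat_const [X in _ <= X]big_mkcond.
apply: leq_sum => x _; case: ifP => xC; last first.
  rewrite leqn0 cards_eq0; apply/eqP/setP=> y; rewrite !inE.
  by apply: contraFF xC => /crit[X [/subsetP XC /XC]].
have [->|/set0Pn[y0]] := eqVneq (outs M x) set0; first by rewrite cards0.
rewrite inE => /crit[X0 [X0C xX0 _ tight0]].
pose T (X : {set V}) := [&& X \subset C, x \in X & #|nbr M X| == k].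
have T0 : T X0 by rewrite /T X0C xX0 tight0 eqxx.
case: (arg_minnP (fun X : {set V} => #|X|) T0) => X /and3P[XC xX /eqP tight] minX.
rewrite -tight; apply: subset_leq_card; apply/subsetP=> y; rewrite !inE => xyM.
apply/andP; split; last by apply/exists_inP; exists x.
have [X' [X'C xX' yX' tight']] := crit _ _ xyM.
have TI : T (X :&: X').
  have IC : X :&: X' \subset C by rewrite subIset ?XC.
  rewrite /T IC inE xX xX' /=.
  have leI : k <= #|nbr M (X :&: X')|.
    by apply: escM; rewrite IC; apply/set0Pn; exists x; rewrite inE xX.
  have leU : k <= #|nbr M (X :|: X')|.
    by apply: escM; rewrite subUset XC X'C; apply/set0Pn; exists x; rewrite inE xX.
  have arith (a b c : nat) : c <= a -> c <= b -> a + b <= c + c -> a == c.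
    by clear; lia.
  by apply: arith leI leU _; rewrite -{1}tight -tight' nbr_uncross.
have /eqP XE : X :&: X' == X by rewrite eqEcard subsetIl minX.
by apply: contra yX'; rewrite -{1}XE inE => /andP[].
Qed.

(** * Disjoint paths *)

(** No arc leads from outside [R] to outside [L], so every path from [A] to [B] meets [L :&: R]. *)
Definition separation (V : finType) (M : {set V * V}) (A B L R : {set V}) :=
  [&& A \subset L, B \subset R, L :|: R == setT &
      [forall p in M, (p.1 \in R) || (p.2 \in L)]].

(* By Menger's theorem, [linked m A B M] means that [M] contains [m] disjoint
   paths from [A] to [B]. *)
Definition linked (V : finType) m (A B : {set V}) (M : {set V * V}) :=
  [forall L : {set V}, forall R : {set V},
    separation M A B L R ==> (m <= #|L :&: R|)].

Lemma separationP (V : finType) (M : {set V * V}) (A B L R : {set V}) :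
  reflect [/\ {subset A <= L}, {subset B <= R}, forall x, x \notin R -> x \in L &
              forall x y, (x, y) \in M -> x \notin R -> y \in L]
          (separation M A B L R).
Proof.
apply: (iffP and4P) => [[/subsetP AL /subsetP BR cov arcs]|[AL BR cov arcs]]; split=> //.
- by move=> x xR; have := in_setT x; rewrite -(eqP cov) inE (negbTE xR) orbF.
- by move=> x y /(forall_inP arcs) /= /orP[->|].
- exact/subsetP.
- exact/subsetP.
- apply/eqP/setP=> x; rewrite !inE; case: (boolP (x \in R)); rewrite ?orbT //.
  by move/cov=> ->.
- apply/forall_inP=> -[x y] /arcs /=; case: (x \in R) => //=; exact.
Qed.

Lemma linkedP (V : finType) m (A B : {set V}) (M : {set V * V}) :
  reflect (forall L R, separation M A B L R -> m <= #|L :&: R|) (linked m A B M).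
Proof.
apply: (iffP forallP) => h L; first by move=> R /(implyP (forallP (h L) R)).
by apply/forallP=> R; apply/implyP/h.
Qed.

Lemma linked_transp (V : finType) m (A B : {set V}) (M : {set V * V}) :
  linked m B A (transp M) = linked m A B M.
Proof.
have imp (N : {set V * V}) A' B' : linked m A' B' N -> linked m B' A' (transp N).
  move/linkedP=> lN; apply/linkedP=> L R /separationP[BL AR cov arcs].
  rewrite setIC; apply: lN; apply/separationP; split=> // x; first exact/contraR/cov.
  move=> y xy; apply: contraR => yR; apply: (arcs y) => //; by rewrite inE.
by apply/idP/idP=> /imp //; rewrite transpK.
Qed.

(** The small separation of [M] without the arc is not one of [M], so the arc itself must cross
    it. *)
Lemma minimal_linked_crit (V : finType) m (A B : {set V}) (M : {set V * V}) u v :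
  minset (linked m A B) M -> (u, v) \in M ->
  exists L R, [/\ separation (M :\ (u, v)) A B L R, u \notin R, v \notin L & #|L :&: R| < m].
Proof.
move=> minM uvM; have := minset_del minM uvM.
rewrite negb_forall => /existsP[L]; rewrite negb_forall => /existsP[R].
rewrite negb_imply -ltnNge => /andP[sepLR lt]; exists L, R.
have : ~~ separation M A B L R.
  have /minsetP[/linkedP lM _] := minM.
  by apply: contraL lt => /lM; rewrite -leqNgt.
move=> nsep; case/separationP: (sepLR) => AL BR cov arcs.
have [uR|uR] := boolP (u \in R).
  case/negP: nsep; apply/separationP; split=> // x y xy xR; apply: arcs (xR).
  by rewrite !inE xy andbT xpair_eqE; apply: contraNN (xR) => /andP[/eqP->].
have [vL|vL] := boolP (v \in L); last by [].
case/negP: nsep; apply/separationP; split=> // x y xy xR.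
have [->//|yv] := eqVneq y v; apply: arcs (xR).
by rewrite !inE xy andbT xpair_eqE (negbTE yv) andbF.
Qed.

(** If [u1] and [u2] differ, uncross the small separations obtained by deleting either arc. One
    corner separates in [M] as it stands, the other once [v] is added to its left side, so the
    orders of the corners sum to at least [2 * m - 1]; but the two separations have order at most
    [m - 1] each. *)
Lemma minimal_linked_in (V : finType) m (A B : {set V}) (M : {set V * V}) u1 u2 v :
  minset (linked m A B) M -> (u1, v) \in M -> (u2, v) \in M -> u1 = u2.
Proof.
move=> minM m1 m2; apply/eqP; apply: contraT => u12.
have [L1 [R1 [/separationP[AL1 BR1 cov1 arcs1] u1R vL1 lt1]]] := minimal_linked_crit minM m1.
have [L2 [R2 [/separationP[AL2 BR2 cov2 arcs2] u2R vL2 lt2]]] := minimal_linked_crit minM m2.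
have /minsetP[/linkedP lM _] := minM.
have ge1 : m <= #|(L1 :&: L2) :&: (R1 :|: R2)|.
  apply: lM; apply/separationP; split=> [x xA|x xB|x|x y xy].
  - by rewrite inE AL1 ?AL2.
  - by rewrite inE BR1.
  - by rewrite !inE negb_or => /andP[/cov1-> /cov2->].
  rewrite !inE negb_or => /andP[xR1 xR2].
  have n1 : (x, y) != (u1, v).
    apply: contraNneq xR2 => -[-> _]; apply: contraR vL2 => u1R2.
    by apply: (arcs2 u1) => //; rewrite !inE m1 xpair_eqE (negbTE u12).
  have n2 : (x, y) != (u2, v).
    apply: contraNneq xR1 => -[-> _]; apply: contraR vL1 => u2R1.
    by apply: (arcs1 u2) => //; rewrite !inE m2 xpair_eqE eq_sym (negbTE u12).
  by rewrite (arcs1 x) ?(arcs2 x) // !inE ?n1 ?n2.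
have ge2 : m <= #|(v |: (L1 :|: L2)) :&: (R1 :&: R2)|.
  apply: lM; apply/separationP; split=> [x xA|x xB|x|x y xy].
  - by rewrite !inE AL1 ?orbT.
  - by rewrite inE BR1 ?BR2.
  - by rewrite !inE negb_and => /orP[/cov1->|/cov2->]; rewrite ?orbT.
  rewrite !inE negb_and; have [//|yv] := eqVneq y v.
  have n u : (x, y) != (u, v) by rewrite xpair_eqE (negbTE yv) andbF.
  by case/orP=> xR; [rewrite (arcs1 x)|rewrite (arcs2 x)]; rewrite ?orbT // !inE n.
have le : #|(v |: (L1 :|: L2)) :&: (R1 :&: R2)| <= #|(L1 :|: L2) :&: (R1 :&: R2)| + 1.
  rewrite setIUl addnC; apply: leq_trans (leq_card_setU _ _).1 _.
  rewrite leq_add2r -(cards1 v); apply: subset_leq_card; exact: subsetIl.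
have eqs : #|(L1 :&: L2) :&: (R1 :|: R2)| + #|(L1 :|: L2) :&: (R1 :&: R2)| =
           #|L1 :&: R1| + #|L2 :&: R2|.
  rewrite !card_set_sum -!big_split; apply: eq_bigr => x _ /=; rewrite !inE.
  have : (x \in R1) || (x \in L1) by case: (boolP (x \in R1)) => // /cov1.
  have : (x \in R2) || (x \in L2) by case: (boolP (x \in R2)) => // /cov2.
  by case: (x \in L1); case: (x \in L2); case: (x \in R1); case: (x \in R2).
have arith (n a b c d e : nat) : n <= a -> n <= b -> b <= c + 1 -> a + c = d + e ->
  d < n -> e < n -> false by clear; lia.
exact: arith ge1 ge2 le eqs lt1 lt2.
Qed.

Lemma minimal_linked_out (V : finType) m (A B : {set V}) (M : {set V * V}) u1 u2 v :
  minset (linked m A B) M -> (v, u1) \in M -> (v, u2) \in M -> u1 = u2.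
Proof.
move=> minM m1 m2.
have minT : minset (linked m B A) (transp M).
  by apply: minset_transp minM => D; apply: linked_transp.
by apply: minimal_linked_in minT _ _; rewrite in_transp; [apply: m1|].
Qed.

(** * Reachability and linkages without shortcuts *)

Definition arel (V : finType) (M : {set V * V}) : rel V := fun x y => (x, y) \in M.

Lemma connect_first (V : finType) (e : rel V) x y :
  connect e x y -> x = y \/ exists2 z, e x z & connect e z y.
Proof.
case/connectP=> -[|z p] /=; first by move=> _ ->; left.
by case/andP=> xz zp ->; right; exists z => //; apply/connectP; exists p.
Qed.

Lemma connect_last (V : finType) (e : rel V) x y :
  connect e x y -> x = y \/ exists2 z, connect e x z & e z y.
Proof.
case/connectP=> p; case/lastP: p => [|p z] /=; first by move=> _ ->; left.
rewrite rcons_path last_rcons => /andP[xp pz] ->; right.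
by exists (last x p) => //; apply/connectP; exists p.
Qed.

Lemma connect_ind_l (V : finType) (e : rel V) (P : V -> Prop) x y :
  P x -> (forall u v, connect e x u -> e u v -> P u -> P v) -> connect e x y -> P y.
Proof.
move=> Px step /connectP[p]; elim/last_ind: p y => [|p z IH] y /=.
  by move=> _ ->.
rewrite rcons_path last_rcons => /andP[xp pz] ->.
apply: (step (last x p)) => //; last exact: IH.
by apply/connectP; exists p.
Qed.

Lemma connect_comparable (V : finType) (e : rel V) x y z :
  (forall u v w, e u v -> e u w -> v = w) ->
  connect e x y -> connect e x z -> connect e y z \/ connect e z y.
Proof.
move=> fe xy xz; pose P u := connect e u z \/ connect e z u.
apply: (connect_ind_l (P := P)) xy => [|u v _ uv]; first by left.
case=> [uz|zu]; last by right; apply: connect_trans zu (connect1 uv).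
case: (connect_first uz) => [zE|[w uw wz]].
  by right; rewrite -zE; apply: connect1.
by left; rewrite (fe _ _ _ uv uw).
Qed.

(** [p] holds the arcs of [k] disjoint paths, the [i]-th from [a i] to [b i]; [cl] tells on which
    path a vertex lies, [None] meaning on none. [linkage_short] excludes shortcuts within a path. *)
Record linkage (V : finType) (t : rel V) k (a b : 'I_k -> V) (cl : V -> option 'I_k)
    (p : {set V * V}) : Prop := Linkage {
  linkage_sub : forall x y, (x, y) \in p -> t x y;
  linkage_out : forall x y z, (x, y) \in p -> (x, z) \in p -> y = z;
  linkage_in : forall x y z, (y, x) \in p -> (z, x) \in p -> y = z;
  linkage_cl : forall x y, (x, y) \in p -> cl x = cl y;
  linkage_dom : forall x y, (x, y) \in p -> cl x != None;
  linkage_start : forall i, cl (a i) = Some i;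
  linkage_end : forall i, cl (b i) = Some i;
  linkage_path : forall i v, cl v = Some i ->
    connect (arel p) (a i) v /\ connect (arel p) v (b i);
  linkage_short : forall x y, connect (arel p) x y -> t x y -> (x, y) \in p }.

Lemma connect_transp (V : finType) (p : {set V * V}) x y :
  connect (arel (transp p)) x y = connect (arel p) y x.
Proof.
rewrite -[RHS]connect_rev; apply: eq_connect => u v /=.
by rewrite /arel in_transp.
Qed.

Lemma linkage_transp (V : finType) (t : rel V) k (a b : 'I_k -> V) cl p :
  linkage t a b cl p -> linkage (conv t) b a cl (transp p).
Proof.
case=> Lsub Lout Lin Lcl Ldom La Lb Lpath Lshort; split=> //.
- by move=> x y; rewrite in_transp => /Lsub.
- by move=> x y z; rewrite !in_transp; apply: Lin.
- by move=> x y z; rewrite !in_transp; apply: Lout.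
- by move=> x y; rewrite in_transp => /Lcl.
- by move=> x y; rewrite in_transp => xy; rewrite -(Lcl _ _ xy); apply: Ldom xy.
- by move=> i v /Lpath[av vb]; rewrite !connect_transp.
- by move=> x y; rewrite connect_transp in_transp; apply: Lshort.
Qed.

(** A separation of order below [k] leaves a vertex of [A] and one of [B] outside [L :&: R]; once
    this set is deleted, no path from the former can enter [R]. *)
Lemma tournament_linked (V : finType) (t : rel V) k (A B : {set V}) :
  strongly_k_connected t k -> 0 < k -> #|A| = k -> #|B| = k ->
  linked k A B [set q | t q.1 q.2].
Proof.
case=> _ conn k0 cA cB; apply/linkedP=> L R /separationP[AL BR cov arcs].
rewrite leqNgt; apply/negP=> lt; set S := L :&: R in lt.
have nsub (Z : {set V}) : #|Z| = k -> exists2 z, z \in Z & z \notin S.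
  move=> cZ; have /subsetPn[z zZ zS] : ~~ (Z \subset S); last by exists z.
  by apply: contraL lt => /subset_leq_card; rewrite cZ -leqNgt.
have [x xA xS] := nsub A cA; have [y yB yS] := nsub B cB.
have lt' : #|S| <= k.-1 by rewrite -ltnS prednK.
have : y \notin R; last by rewrite BR.
have xR : x \notin R by move: xS; rewrite inE (AL _ xA).
apply: (connect_ind_l (P := fun z => z \notin R) xR _ (conn S lt' x y xS yS)).
move=> u v _ /and3P[tuv _ vS] uR.
by move: vS; rewrite inE (arcs u v _ uR) // inE.
Qed.

Lemma minimal_linked_start (V : finType) m (A B : {set V}) (M : {set V * V}) u v :
  minset (linked m A B) M -> (u, v) \in M -> v \notin A.
Proof.
move=> minM uv; have [L [R [/separationP[AL _ _ _] _ vL _]]] := minimal_linked_crit minM uv.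
by apply: contra vL; apply: AL.
Qed.

Lemma minimal_linked_end (V : finType) m (A B : {set V}) (M : {set V * V}) u v :
  minset (linked m A B) M -> (u, v) \in M -> u \notin B.
Proof.
move=> minM uv; have [L [R [/separationP[_ BR _ _] uR _ _]]] := minimal_linked_crit minM uv.
by apply: contra uR; apply: BR.
Qed.

(** If the set [Z] reached from [a] missed [B], then [(A :|: Z, ~: Z)] would be a separation of
    order less than [#|A|], since [a] is in [Z]. *)
Lemma linked_reach (V : finType) (A B : {set V}) (M : {set V * V}) a :
  linked #|A| A B M -> a \in A -> exists2 b, b \in B & connect (arel M) a b.
Proof.
move=> /linkedP lM aA; pose Z := [set x | connect (arel M) a x].
have [/exists_inP[b bB ab]|nB] := boolP [exists b in B, connect (arel M) a b].
  by exists b.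
have := lM (A :|: Z) (~: Z) _; rewrite leqNgt => /(_ _)/negP[].
  apply/separationP; split=> [x xA|x xB|x|x y xy].
  - by rewrite inE xA.
  - by rewrite !inE; apply: contra nB => ax; apply/exists_inP; exists x.
  - by rewrite !inE negbK => ->; rewrite orbT.
  - by rewrite !inE negbK => ax; rewrite (connect_trans ax (connect1 xy)) orbT.
apply: proper_card; apply/properP; split.
  by apply/subsetP=> x; rewrite !inE; case: (x \in A) => //=; case: connect.
by exists a; rewrite // !inE connect0 andbF.
Qed.

(* In a linking arc set of least cardinality no path has a shortcut: replacing
   the path by the shortcut keeps every separation large. *)
Lemma least_linked_short (V : finType) m (A B : {set V}) (F M : {set V * V}) v s :
  (forall x, (x, x) \notin F) -> M \subset F ->
  minset (linked m A B) M ->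
  (forall M' : {set V * V}, M' \subset F -> linked m A B M' -> #|M| <= #|M'|) ->
  connect (arel M) v s -> (v, s) \in F -> (v, s) \in M.
Proof.
move=> irF MF minM least vs vsF; apply: contraT => vsM.
case/connectP: vs => p0 p0v ->{s} in vsF vsM *.
case: (shortenP p0v) vsF vsM => p pv up _ vsF vsM {p0 p0v}.
case/lastP: p => [|q s] in pv up vsF vsM *; first by rewrite (negbTE (irF v)) in vsF.
rewrite last_rcons in vsF vsM.
have nout w : w \in q -> exists2 z, z \in rcons q s & (w, z) \in M.
  move=> wq; move: pv up; case/splitPr: wq => q1 q2.
  rewrite rcons_cat rcons_cons cat_path => /andP[_] /= /andP[_].
  case: q2 => [|z q2] /= /andP[wz _] _.
    by exists s; rewrite // mem_cat !inE eqxx !orbT.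
  by exists z; rewrite // mem_cat !inE eqxx !orbT.
have nin w : w \in q -> exists2 z, z \in v :: q & (z, w) \in M.
  move=> wq; move: pv up; case/splitPr: wq => q1 q2.
  rewrite rcons_cat rcons_cons cat_path => /andP[_] /= /andP[zw _] _.
  exists (last v q1) => //; have := mem_last v q1.
  by rewrite !inE mem_cat => /orP[->//|->]; rewrite orbT.
have sq : s \notin q by move: up; rewrite /= rcons_uniq => /andP[_ /andP[]].
have vq : v \notin q.
  by move: up; rewrite /= mem_rcons inE negb_or => /andP[/andP[]].
(* All arcs at the interior [q] of the path are dropped; the single arc [(v, s)] is to replace
   them. *)
pose M1 := [set e in M | (e.1 \notin q) && (e.2 \notin q)].
have [M1s M1M] : M1 \subset M /\
    forall x y, (x, y) \in M -> x \notin q -> y \notin q -> (x, y) \in M1.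
  split=> [|x y xy xq yq]; last by rewrite inE xy xq.
  by apply/subsetP=> e; rewrite inE => /andP[].
have linkM' : linked m A B ((v, s) |: M1).
  have /minsetP[/linkedP lM _] := minM.
  apply/linkedP=> L R /separationP[AL BR cov arcs].
  have arcs1 x y : (x, y) \in M -> x \notin q -> y \notin q -> x \notin R -> y \in L.
    by move=> xy xq yq; apply: arcs; rewrite inE M1M ?orbT.
  have arcvs : v \notin R -> s \in L by apply: arcs; rewrite !inE eqxx.
  (* The interior is moved to the left if [s] is there; otherwise the arc [(v, s)] forces [v] into
     [R] and the interior is moved to the right. Either way the result separates in [M] and its
     order does not grow. *)
  have [sL|sL] := boolP (s \in L).
    have sep : separation M A B (L :|: [set x in q]) (R :\: [set x in q]).
      apply/separationP; split=> [x xA|x xB|x|x y xy].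
      - by rewrite inE AL.
      - rewrite !inE BR // andbT; apply/negP=> /nout[z _ xz].
        by have := minimal_linked_end minM xz; rewrite xB.
      - by rewrite !inE negb_and negbK => /orP[->|/cov->]; rewrite ?orbT.
      - rewrite !inE negb_and negbK; have [//|yq] := boolP (y \in q); first by rewrite orbT.
        rewrite orbF; have [xq _|xq xR] := boolP (x \in q); last exact: arcs1 xR.
        have [z] := nout x xq; rewrite mem_rcons inE => zqs xz.
        move: zqs; rewrite -(minimal_linked_out minM xy xz) (negbTE yq) orbF.
        by move/eqP=> ->.
    apply: leq_trans (lM _ _ sep) (subset_leq_card _).
    by apply/subsetP=> x; rewrite !inE; case: (x \in q); rewrite /= ?orbF ?andbF.
  have vR : v \in R by apply: contraNT sL => vR; apply: arcvs.
  have sep : separation M A B (L :\: [set x in q]) (R :|: [set x in q]).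
    apply/separationP; split=> [x xA|x xB|x|x y xy].
    - rewrite !inE AL // andbT; apply/negP=> /nin[z _ zx].
      by have := minimal_linked_start minM zx; rewrite xA.
    - by rewrite inE BR.
    - by rewrite !inE negb_or => /andP[/cov-> ->].
    - rewrite !inE negb_or => /andP[xR xq].
      have [yq|yq] := boolP (y \in q); last exact: arcs1 xR.
      have [z] := nin y yq; rewrite inE => zvq zy.
      by move: zvq; rewrite -(minimal_linked_in minM xy zy) (negbTE xq) orbF => /eqP xv;
         rewrite xv vR in xR.
  apply: leq_trans (lM _ _ sep) (subset_leq_card _).
  by apply/subsetP=> x; rewrite !inE; case: (x \in q); rewrite /= ?orbF.
have : #|M| <= #|(v, s) |: M1|.
  by apply: least linkM'; rewrite subUset sub1set vsF (subset_trans M1s).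
case: q => [|w q] in pv sq vq M1 M1s M1M nout nin up linkM' *.
  by move: pv; rewrite /= /arel (negbTE vsM).
have vw : (v, w) \in M by move: pv => /= /andP[].
have ls : (last w q, s) \in M.
  by move: pv; rewrite rcons_path => /andP[_].
(* [M1] misses the first and the last arc of the path, which are distinct, while only one arc is
   added: this contradicts the choice of [M]. *)
have sub : M1 \subset M :\ (v, w) :\ (last w q, s).
  apply/subsetP=> e eM1; rewrite !inE (subsetP M1s _ eM1) andbT.
  move: eM1; rewrite inE => /and3P[_ e1 e2]; apply/andP; split.
    by apply: contraNneq e1 => ->; apply: mem_last.
  by apply: contraNneq e2 => ->; apply: mem_head.
have lsw : (last w q, s) != (v, w).
  by apply: contraNneq sq => -[_ ->]; apply: mem_head.
have := subset_leq_card sub; have := cardsD1 (v, w) M.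
have := cardsD1 (last w q, s) (M :\ (v, w)).
rewrite vw !inE lsw ls /= cardsU1.
have arith (a b c d n : nat) : b = 1 + c -> a = 1 + b -> d <= c -> n <= 1 ->
    a <= n + d -> false by clear; lia.
by move=> e1 e2 e3; apply: arith e1 e2 e3 (leq_b1 _).
Qed.

Lemma least_linked (V : finType) m (A B : {set V}) (F : {set V * V}) :
  linked m A B F -> exists M : {set V * V},
    [/\ M \subset F, minset (linked m A B) M &
        forall M' : {set V * V}, M' \subset F -> linked m A B M' -> #|M| <= #|M'|].
Proof.
move=> lF; pose P (M : {set V * V}) := (M \subset F) && linked m A B M.
have PF : P F by rewrite /P subxx.
case: (arg_minnP (fun M : {set V * V} => #|M|) PF) => M /andP[MF lM] minM.
have least (M' : {set V * V}) : M' \subset F -> linked m A B M' -> #|M| <= #|M'|.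
  by move=> M'F lM'; apply: minM; rewrite /P M'F.
exists M; split=> //; apply/minsetP; split=> // M' lM' M'M.
by apply/eqP; rewrite eqEcard M'M least // (subset_trans M'M).
Qed.

(** In a least linking arc set all in- and out-degrees are at most one, no arc enters [A] and none
    leaves [B], so following arcs from [A] traces disjoint paths to [B]. *)
Lemma linkage_exists (V : finType) (t : rel V) k (A B : {set V}) :
  is_tournament t -> strongly_k_connected t k -> 0 < k -> #|A| = k -> #|B| = k ->
  exists (a b : 'I_k -> V) cl p,
    [/\ linkage t a b cl p, forall x, x \in A <-> exists i, x = a i &
        forall x, x \in B <-> exists i, x = b i].
Proof.
move=> tt tc k0 cA cB; have lF := tournament_linked tc k0 cA cB; subst k.
set F := [set q | _] in lF; have [M [MF minM least]] := least_linked lF.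
have irF x : (x, x) \notin F by rewrite inE /= (tt.1 x).
have MC := minsetp minM.
have oM x y z : arel M x y -> arel M x z -> y = z by apply: minimal_linked_out minM.
have iM x y z : arel M y x -> arel M z x -> y = z by apply: minimal_linked_in minM.
have sM x y : arel M x y -> y \notin A by apply: minimal_linked_start minM.
have eM x y : arel M x y -> x \notin B by apply: minimal_linked_end minM.
have shortM := least_linked_short irF MF minM least.
pose a (i : 'I_#|A|) := enum_val i.
have aA i : a i \in A := enum_valP i.
have ex i : exists b, (b \in B) && connect (arel M) (a i) b.
  by have [b bB ab] := linked_reach MC (aA i); exists b; rewrite bB.
have [b bP] := fin_all_exists ex.
have bB i : b i \in B by case/andP: (bP i).
have ab i : connect (arel M) (a i) (b i) by case/andP: (bP i).
have uniq_src i j v : connect (arel M) (a i) v -> connect (arel M) (a j) v -> i = j.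
  move=> iv; pose P u := connect (arel M) (a j) u -> i = j.
  apply: (connect_ind_l (P := P)) iv => [|u w _ uw IH] ju.
    case: (connect_last ju) => [/enum_val_inj //|[z _ /sM]].
    by rewrite aA.
  case: (connect_last ju) => [jw|[z jz zw]]; first by have := sM _ _ uw; rewrite -jw aA.
  by apply: IH; rewrite (iM _ _ _ uw zw).
have bI : injective b by move=> i j bij; apply: uniq_src (ab i) _; rewrite bij.
have codomB : [set b i | i in 'I_#|A|] = B.
  apply/eqP; rewrite eqEcard card_imset // card_ord cB leqnn andbT.
  by apply/subsetP=> x /imsetP[i _ ->].
pose cl v := [pick i | connect (arel M) (a i) v].
have clP i v : connect (arel M) (a i) v -> cl v = Some i.
  move=> iv; rewrite /cl; case: pickP => [j jv|/(_ i)]; last by rewrite iv.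
  by rewrite (uniq_src _ _ _ iv jv).
have clE i v : cl v = Some i -> connect (arel M) (a i) v.
  by rewrite /cl; case: pickP => // j jv [<-].
pose p := [set q in M | cl q.1 != None].
have pM x y : (x, y) \in p -> arel M x y by rewrite inE => /andP[].
have clstep x y : cl x != None -> arel M x y -> cl y = cl x.
  case E: (cl x) => [i|] // _ xy; apply: clP.
  by apply: connect_trans (clE _ _ E) (connect1 xy).
have Mp i x y : cl x = Some i -> connect (arel M) x y -> connect (arel p) x y.
  move=> cx xy; pose P u := cl u = Some i /\ connect (arel p) x u.
  suff : P y by case.
  apply: (connect_ind_l (P := P)) xy => [|u v _ uv [cu xu]]; first by split.
  have cu' : cl u != None by rewrite cu.
  split; first by rewrite (clstep _ _ cu' uv).
  by apply: connect_trans xu (connect1 _); rewrite /arel inE; apply/andP; split; [exact: uv|].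
exists a, b, cl, p; split; last 2 first.
- move=> x; split=> [xA|[i ->] //].
  by exists (enum_rank_in xA x); rewrite /a enum_rankK_in.
- move=> x; rewrite -codomB; split=> [/imsetP[i _ ->]|[i ->]]; first by exists i.
  exact: imset_f.
split.
- by move=> x y /pM /(subsetP MF); rewrite inE.
- by move=> x y z /pM xy /pM; apply: oM.
- by move=> x y z /pM xy /pM; apply: iM.
- by move=> x y; rewrite inE => /andP[/= xy cx]; rewrite (clstep _ _ cx xy).
- by move=> x y; rewrite inE => /andP[].
- by move=> i; apply: clP.
- by move=> i; apply: clP.
- move=> i v cv; split; first exact: Mp (clP i _ (connect0 _ _)) (clE _ _ cv).
  (* [v] and [b i] are comparable, and no arc leaves [B], so [b i] comes last. *)
  apply: Mp (cv) _; case: (connect_comparable oM (clE _ _ cv) (ab i)) => // bv.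
  case: (connect_first bv) => [->|[z /eM]]; first exact: connect0.
  by rewrite bB.
- move=> x y xy txy; have [xyE|[z xz _]] := connect_first xy.
    by move: txy; rewrite xyE (negbTE (tt.1 y)).
  move: xz; rewrite /arel inE => /andP[_ /= cx].
  rewrite inE cx andbT; apply: shortM; last by rewrite inE.
  by apply: connect_sub xy => u v /pM uv; apply: connect1.
Qed.

(** * Degrees in tournaments *)

Definition outN (V : finType) (t : rel V) x := [set y | t x y].

Definition lowest (V : finType) (f : V -> nat) (A : {set V}) :=
  forall a w, a \in A -> w \notin A -> f a <= f w.

Lemma lowest_exists (V : finType) (f : V -> nat) k :
  k <= #|V| -> exists2 A : {set V}, #|A| = k & lowest f A.
Proof.
elim: k => [|k IH] kV; first by exists set0; rewrite ?cards0 // => a w; rewrite inE.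
have [A cA lA] := IH (ltnW kV).
have /set0Pn[x0] : ~: A != set0 by rewrite -card_gt0 cardsCs setCK cA subn_gt0.
rewrite inE => x0A; case: (arg_minnP (P := fun x => x \notin A) f x0A) => x xA minx.
exists (x |: A); first by rewrite cardsU1 xA cA.
move=> a w; rewrite !inE negb_or => /predU1P[->|aA] /andP[wx wA].
  exact: minx.
exact: lA.
Qed.

Lemma card_outN_conv (V : finType) (t : rel V) x :
  is_tournament t -> #|outN t x| + #|outN (conv t) x| + 1 = #|V|.
Proof.
move=> tt; rewrite -[in RHS]cardsT (cardsD1 x setT) in_setT addnC; congr addn.
rewrite -[RHS](cardsID (outN t x)); congr addn; apply: eq_card => y; rewrite !inE.
  by rewrite andbT; case: eqP => [->|] //=; rewrite (negbTE (tt.1 x)).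
rewrite /conv andbT; have [->|yx] := eqVneq y x; first by rewrite (negbTE (tt.1 x)) andbF.
by rewrite (tournamentN tt yx) andbT negbK.
Qed.

Lemma card_low_outN (V : finType) (t : rel V) d :
  is_tournament t -> #|[set v | #|outN t v| < d]| <= 2 * d.
Proof.
move=> tt; set L := [set v | _].
have [->|L0] := eqVneq L set0; first by rewrite cards0.
have [v vL] := tournament_half tt L0; rewrite inE in vL.
have : #|[set w in L | t v w]| <= #|outN t v|.
  by apply: subset_leq_card; apply/subsetP=> w; rewrite !inE => /andP[].
have arith (a b c e : nat) : c < e -> b <= c -> a <= 2 * b + 1 -> a <= 2 * e.
  by clear; lia.
exact: arith vL.
Qed.

(** Some [v] among [b] and the vertices outside [B] dominates half of the others; the in-degree of
    [b] is at most that of [v], so its out-degree is no smaller. *)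
Lemma lowest_conv_outN (V : finType) (t : rel V) (B : {set V}) b :
  is_tournament t -> lowest (fun v => #|outN (conv t) v|) B -> b \in B ->
  #|V| <= 2 * #|outN t b| + #|B|.
Proof.
move=> tt lB bB; set G := b |: ~: B.
have G0 : G != set0 by apply/set0Pn; exists b; rewrite !inE eqxx.
have cG : #|G| = #|V| - #|B| + 1.
  by rewrite cardsU1 inE bB cardsCs setCK addnC.
have [v vG] := tournament_half tt G0.
have : #|[set w in G | t v w]| <= #|outN t v|.
  by apply: subset_leq_card; apply/subsetP=> w; rewrite !inE => /andP[].
have : #|outN t v| <= #|outN t b|.
  move: vG; rewrite !inE => /predU1P[->//|vB].
  have := lB _ _ bB vB; have := card_outN_conv b tt; have := card_outN_conv v tt.
  by move: #|V| #|outN t b| #|outN t v| #|outN (conv t) v| #|outN (conv t) b|; clear; lia.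
have : #|B| <= #|V| by apply: max_card.
by rewrite cG; move: #|V| #|B| #|outN t b| #|outN t v| #|[set w in G | t v w]|; clear; lia.
Qed.

(** Out-neighbours of [a] with too few continuations to in-neighbours of [a]; they are avoided when
    routes to [a] are chosen. *)
Definition bad (V : finType) (t : rel V) a d :=
  [set w | t a w && (#|outN t w :\: outN t a| < d)].

(** Some bad [v] outside [A] is dominated by half of the others; these lie in [outN t a] but not in
    [outN t v]. As [a] has least out-degree, they number at most [#|outN t v :\: outN t a| < d]. *)
Lemma card_bad (V : finType) (t : rel V) (A : {set V}) a d :
  is_tournament t -> lowest (fun v => #|outN t v|) A -> a \in A ->
  #|bad t a d| <= 2 * d + #|A|.
Proof.
move=> tt lA aA; rewrite -(cardsID A (bad t a d)) addnC.
apply: leq_add; last by apply: subset_leq_card; apply: subsetIr.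
set F := bad t a d :\: A.
have [->|F0] := eqVneq F set0; first by rewrite cards0.
have [v vF half] := tournament_half (tournament_conv tt) F0.
have sub : [set w in F | conv t v w] \subset outN t a :\: outN t v.
  apply/subsetP=> w; rewrite !inE /conv => /andP[/and3P[_ aw _] wv].
  by rewrite aw (tournament_asym tt wv).
move: vF; rewrite !inE => /and3P[vA _ lt]; have le := lA _ _ aA vA.
have := cardsID (outN t v) (outN t a); have := cardsID (outN t a) (outN t v).
rewrite [outN t v :&: _]setIC; move: (subset_leq_card sub) half lt le.
move: #|F| #|[set w in F | conv t v w]| #|outN t a :\: _| #|outN t v :\: _|.
move: #|outN t a| #|outN t v| #|_ :&: _|.
by clear; lia.
Qed.

(** Pigeonhole over the [k + 1] values of [cl], [None] included: [2 * (k + 1) + 1] vertices force a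
    value taken three times. *)
Lemma homogeneous_triple (V : finType) k (cl : V -> option 'I_k) (C : {set V}) :
  2 * k + 3 <= #|C| -> exists Z : {set V},
    [/\ Z \subset C, #|Z| = 3 & forall y z, y \in Z -> z \in Z -> cl y = cl z].
Proof.
move=> big; have [c lt] : exists c, 2 < #|[set x in C | cl x == c]|.
  apply/existsP; apply: contraLR big => /existsPn small; rewrite -ltnNge.
  have -> : #|C| = \sum_c #|[set x in C | cl x == c]|.
    rewrite -sum1_card (partition_big cl predT) //=; apply: eq_bigr => c _.
    by rewrite sum1dep_card.
  have : \sum_c #|[set x in C | cl x == c]| <= \sum_(c : option 'I_k) 2.
    by apply: leq_sum => c _; rewrite leqNgt.
  by rewrite sum_nat_const card_option card_ord; clear; lia.
have c0 : #|set0 : {set V}| <= 3 by rewrite cards0.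
have [Z [_ ZC cZ]] := set_between (sub0set [set x in C | cl x == c]) c0 lt.
exists Z; split=> //.
  by apply: subset_trans ZC _; apply/subsetP=> x; rewrite inE => /andP[].
move=> y z /(subsetP ZC); rewrite inE => /andP[_ /eqP->].
by move=> /(subsetP ZC); rewrite inE => /andP[_ /eqP->].
Qed.

Lemma card_bigcup_le (I V : finType) (P : pred I) (F : I -> {set V}) :
  #|\bigcup_(i | P i) F i| <= \sum_(i | P i) #|F i|.
Proof.
elim/big_rec2: _ => [|i n A _ le]; first by rewrite cards0.
by apply: leq_trans (leq_card_setU _ _).1 _; rewrite leq_add2l.
Qed.

Lemma sum_card_disjoint (I V : finType) (P : pred I) (F : I -> {set V}) (T : {set V}) :
  (forall i, P i -> F i \subset T) ->
  (forall i j, P i -> P j -> i != j -> [disjoint F i & F j]) ->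
  \sum_(i | P i) #|F i| <= #|T|.
Proof.
move=> FT disj; under eq_bigr do rewrite card_set_sum.
rewrite exchange_big /= card_set_sum; apply: leq_sum => x _.
have [/existsP[i /andP[Pi xi]]|none] := boolP [exists i, P i && (x \in F i)].
  rewrite (bigD1 i) //= xi (subsetP (FT i Pi) _ xi) big1 // => j /andP[Pj ji].
  by rewrite (disjointFl (disj _ _ Pj Pi ji) xi).
rewrite big1 // => i Pi; move/existsPn: none => /(_ i); rewrite Pi /=.
by move/negbTE->.
Qed.

(** * Fans to the starting points of the linkage *)

Definition closed_minus (V : finType) (S : {set V}) (H : {set V * V}) (X : {set V}) :=
  forall u v, u \in X -> (u, v) \in H -> v \notin S -> v \in X.

Lemma closed_minus_sub (V : finType) (S X : {set V}) (H H' : {set V * V}) :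
  H' \subset H -> closed_minus S H X -> closed_minus S H' X.
Proof. by move=> /subsetP HH' clX u v uX /HH'; apply: clX. Qed.

Definition arcs_of (V : finType) (t : rel V) : {set V * V} := [set q | t q.1 q.2].

Definition monochromatic (V : finType) (C : eqType) (cl : V -> C) (G : {set V}) :=
  forall y z, y \in G -> z \in G -> cl y = cl z.

(* The arcs [H] lead from [x] to [a] through the vertices of [M] in such a way
   that a deleted set [S] separating [a] from [x] contains three vertices of [M]
   on the same path of the linkage, or three vertices of [M] on none. *)
Definition gadget (V : finType) (C : eqType) (cl : V -> C) x a (M : {set V}) (H : {set V * V}) :=
  forall S X : {set V}, x \in X -> closed_minus S H X -> a \notin S -> a \notin X ->
    exists G : {set V}, [/\ G \subset S :&: M, #|G| = 3 & monochromatic cl G].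

(** Three out-neighbours [Z] of [x] with equal [cl] are chosen, and for each [z] in [Z] that is
    neither [a] nor an in-neighbour of [a], three routes [z -> y -> a] whose middle vertices have
    equal [cl]. Cutting [x] off from [a] requires deleting all of [Z] or all of some such [Y z]. *)
Lemma gadget_exists (V : finType) (t : rel V) k (cl : V -> option 'I_k) (A U : {set V}) x a :
  is_tournament t -> lowest (fun v => #|outN t v|) A -> #|A| = k -> a \in A ->
  #|U| + 12 <= 12 * k -> 43 * k <= #|outN t x| ->
  exists (M : {set V}) (H : {set V * V}),
    [/\ H \subset arcs_of t, #|H| <= 24, #|M| <= 12, [disjoint M & U] &
        gadget cl x a M H].
Proof.
move=> tt lA cA aA cU dx.
(* Since [#|U| <= 12 * k - 12], the threshold [14 * k - 9] leaves [2 * k + 3] choices for each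
   [Y z]; the at most [29 * k - 18] bad vertices leave enough of the [43 * k] for [Z]. *)
have [Z [ZC cZ Zcl]] : exists Z : {set V}, [/\ Z \subset outN t x :\: bad t a (14 * k - 9) :\: U,
    #|Z| = 3 & monochromatic cl Z].
  apply: homogeneous_triple; rewrite !cardsD.
  have := card_bad (14 * k - 9) tt lA aA; rewrite cA.
  have := subset_leq_card (subsetIr (outN t x) (bad t a (14 * k - 9))).
  have := subset_leq_card (subsetIr (outN t x :\: bad t a (14 * k - 9)) U).
  have arith (u d b i j : nat) : u + 12 <= 12 * k -> 43 * k <= d ->
      i <= u -> j <= b -> b <= 2 * (14 * k - 9) + k -> 2 * k + 3 <= d - j - i.
    by clear; lia.
  exact: arith cU dx.
have ZP z : z \in Z -> [/\ t x z, z \notin bad t a (14 * k - 9) & z \notin U].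
  by move/(subsetP ZC); rewrite !inE => /and3P[-> -> ->].
have exY z : exists Y : {set V}, z \in Z -> [/\ #|Y| <= 3, [disjoint Y & U],
    forall y, y \in Y -> t z y && t y a &
    ~~ [|| z == a | t z a] -> #|Y| = 3 /\ monochromatic cl Y].
  have [zZ|] := boolP (z \in Z); last by exists set0.
  have [_|za] := boolP [|| z == a | t z a].
    exists set0 => _; rewrite cards0; split=> // [|y]; last by rewrite inE.
    by rewrite disjoints_subset sub0set.
  have [xz zbad zU] := ZP z zZ; move: za; rewrite negb_or => /andP[za tza].
  have taz : t a z by rewrite (tournamentN tt za).
  have [Y [YC cY Ycl]] : exists Y : {set V}, [/\ Y \subset outN t z :\: outN t a :\: U,
      #|Y| = 3 & monochromatic cl Y].
    apply: homogeneous_triple; rewrite cardsD.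
    have := subset_leq_card (subsetIr (outN t z :\: outN t a) U).
    move: zbad; rewrite inE taz /= -leqNgt.
    have arith (u d i : nat) : u + 12 <= 12 * k -> 14 * k - 9 <= d -> i <= u ->
        2 * k + 3 <= d - i by clear; lia.
    exact: arith cU.
  exists Y => _; rewrite cY; split=> // [|y /(subsetP YC)].
    rewrite disjoints_subset; apply: subset_trans YC _.
    by apply/subsetP=> y; rewrite !inE => /andP[].
  rewrite !inE => /and3P[_ ay zy]; rewrite zy (tournamentN tt) //.
  by apply: contraNneq tza => ->.
have [Y YP] := fin_all_exists exY.
pose h z := [set (z, a)] :|: ([set (z, y) | y in Y z] :|: [set (y, a) | y in Y z]).
exists (Z :|: \bigcup_(z in Z) Y z).
exists (arcs_of t :&: ([set (x, z) | z in Z] :|: \bigcup_(z in Z) h z)); split.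
- exact: subsetIl.
- apply: leq_trans (subset_leq_card (subsetIr _ _)) _.
  apply: leq_trans (leq_card_setU _ _).1 _.
  have le1 := leq_imset_card (fun z => (x, z)) (mem Z).
  (* Per [z]: one direct arc, three arcs to [Y z] and three from it; with the three arcs out of [x]
     this makes [3 + 3 * 7]. *)
  have le2 : #|\bigcup_(z in Z) h z| <= \sum_(z in Z) 7.
    apply: leq_trans (card_bigcup_le _ _) _; apply: leq_sum => z zZ.
    have [cY _ _ _] := YP z zZ.
    apply: leq_trans (leq_card_setU _ _).1 _; rewrite cards1.
    have [le _] := leq_card_setU [set (z, y) | y in Y z] [set (y, a) | y in Y z].
    have arith (n u c d : nat) : n <= 3 -> u <= c + d -> c <= n -> d <= n -> 1 + u <= 7.
      by clear; lia.
    by apply: arith cY le _ _; apply: leq_imset_card.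
  move: le1 le2; rewrite sum_nat_const cZ; exact: (@leq_add _ _ 3 21).
- apply: leq_trans (leq_card_setU _ _).1 _; rewrite cZ.
  have le : #|\bigcup_(z in Z) Y z| <= \sum_(z in Z) 3.
    by apply: leq_trans (card_bigcup_le _ _) _; apply: leq_sum => z /YP[].
  by move: le; rewrite sum_nat_const cZ; move: #|_|; clear; lia.
- rewrite disjoints_subset subUset; apply/andP; split.
    by apply/subsetP=> z /ZP[_ _]; rewrite inE.
  by apply/bigcupsP=> z /YP[_ + _ _]; rewrite disjoints_subset.
move=> S X xX clX aS aX.
have inH u v : t u v -> (u, v) \in [set (x, z) | z in Z] :|: \bigcup_(z in Z) h z ->
    u \in X -> v \notin S -> v \in X.
  by move=> uv uvh uX vS; apply: clX uX _ vS; rewrite inE inE uv.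
have [ZS|/subsetPn[z zZ zS]] := boolP (Z \subset S).
  by exists Z; split=> //; rewrite subsetI ZS subsetUl.
have [xz _ _] := ZP z zZ; have [_ _ Yt Yza] := YP z zZ.
have zX : z \in X by apply: inH xz _ xX zS; rewrite inE imset_f.
have hH : {subset h z <= [set (x, z) | z in Z] :|: \bigcup_(z in Z) h z}.
  by move=> e eh; rewrite inE; apply/orP; right; apply/bigcupP; exists z.
have nza : ~~ [|| z == a | t z a].
  apply: contra aX => /orP[/eqP<- //|za].
  by apply: inH za _ zX aS; apply: hH; rewrite !inE eqxx.
have [cY Ycl] := Yza nza; exists (Y z); split=> //.
rewrite subsetI; apply/andP; split; last first.
  by apply: subset_trans (subsetUr _ _); apply: bigcup_sup zZ.
apply/subsetP=> y yY; have /andP[zy ya] := Yt y yY.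
apply: contraR aX => yS; have yX : y \in X.
  by apply: inH zy _ zX yS; apply: hH; rewrite !inE imset_f ?orbT.
by apply: inH ya _ yX aS; apply: hH; rewrite !inE; apply/or3P/Or33/imset_f.
Qed.

(** The gadgets are built in turn, each avoiding the at most [12 * (k - 1)] vertices used by the
    earlier ones. *)
Lemma fan_exists (V : finType) (t : rel V) k (cl : V -> option 'I_k) (A : {set V})
    (a : 'I_k -> V) x :
  is_tournament t -> lowest (fun v => #|outN t v|) A -> #|A| = k ->
  (forall i, a i \in A) -> 43 * k <= #|outN t x| ->
  exists (M : 'I_k -> {set V}) (H : {set V * V}),
    [/\ H \subset arcs_of t, #|H| <= 24 * k,
        forall i j, i != j -> [disjoint M i & M j] &
        forall i, gadget cl x (a i) (M i) H].
Proof.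
move=> tt lA cA aA dx.
have step n : n <= k -> exists (M : 'I_k -> {set V}) (H : {set V * V}),
    [/\ H \subset arcs_of t, #|H| <= 24 * n,
        forall i j : 'I_k, i < n -> j < n -> i != j -> [disjoint M i & M j],
        forall i : 'I_k, i < n -> #|M i| <= 12 &
        forall i : 'I_k, i < n -> gadget cl x (a i) (M i) H].
  elim: n => [_|n IH nk].
    by exists (fun _ => set0), set0; rewrite cards0 sub0set; split.
  have [M [H [Ht cH disj cM gM]]] := IH (ltnW nk); pose m := Ordinal nk.
  pose U := \bigcup_(i : 'I_k | i < n) M i.
  have cU : #|U| + 12 <= 12 * k.
    have le : #|U| <= \sum_(i : 'I_k | i < n) 12.
      by apply: leq_trans (card_bigcup_le _ _) _; apply: leq_sum.
    move: le; rewrite sum_nat_const.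
    have -> : #|[pred i : 'I_k | i < n]| = n.
      by rewrite -sum1_card (big_ord_narrow (ltnW nk)) sum1_card card_ord.
    have arith (u c d : nat) : c < d -> u <= c * 12 -> u + 12 <= 12 * d by clear; lia.
    exact: arith nk.
  have [M' [H' [Ht' cH' cM' disj' gM']]] := gadget_exists cl tt lA cA (aA m) cU dx.
  exists (fun i => if i == m then M' else M i), (H :|: H').
  have lt (i : 'I_k) : i < n.+1 -> i != m -> i < n.
    by rewrite ltnS leq_eqVlt => /predU1P[/= im|//]; rewrite -val_eqE /= im eqxx.
  have dM' (i : 'I_k) : i < n -> [disjoint M' & M i].
    move=> i_n; rewrite disjoint_sym disjoints_subset.
    move: disj'; rewrite disjoint_sym disjoints_subset; apply: subset_trans.
    exact: bigcup_sup.
  split.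
  - by rewrite subUset Ht.
  - by apply: leq_trans (leq_card_setU _ _).1 _; rewrite mulnS addnC leq_add.
  - move=> i j i_n j_n ij; case: eqP => [im|/eqP im]; case: eqP => [jm|/eqP jm].
    + by rewrite im jm eqxx in ij.
    + exact/dM'/lt.
    + by rewrite disjoint_sym; apply/dM'/lt.
    + by apply: disj => //; apply: lt.
  - by move=> i i_n; case: eqP => [_|/eqP im] //; apply/cM/lt.
  - move=> i i_n S X xX clX; case: eqP => [->|/eqP im].
      by apply: gM' xX _; apply: closed_minus_sub clX; apply: subsetUr.
    by apply: (gM i (lt i i_n im)) xX _; apply: closed_minus_sub clX; apply: subsetUl.
have [M [H [Ht cH disj _ gM]]] := step k (leqnn k).
by exists M, H; split=> // [i j|i]; [apply: disj|apply: gM].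
Qed.

Definition unblocked (V : finType) k (cl : V -> option 'I_k) (S : {set V}) :=
  [set i | [forall s in S, cl s != Some i]].

(** Each unreached unblocked path forces three vertices of [S] with equal [cl] in its own part
    [M i]. Let [R] contain one vertex of [S] for each blocked path. It has at most one vertex in
    each triple, so every triple takes two vertices of [S :\: R], a set with fewer than
    [#|unblocked cl S|] elements. *)
Lemma fan_majority (V : finType) k (cl : V -> option 'I_k) (a : 'I_k -> V) x
    (M : 'I_k -> {set V}) (H : {set V * V}) (S X : {set V}) :
  (forall i, cl (a i) = Some i) ->
  (forall i j, i != j -> [disjoint M i & M j]) ->
  (forall i, gadget cl x (a i) (M i) H) ->
  #|S| < k -> x \in X -> closed_minus S H X ->
  2 * #|[set i in unblocked cl S | a i \notin X]| < #|unblocked cl S|.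
Proof.
move=> cla disj gM Sk xX clX; set I := unblocked cl S; set I2 := [set i in I | _].
have exG i : exists G : {set V}, i \in I2 ->
    [/\ G \subset S :&: M i, #|G| = 3 & monochromatic cl G].
  have [|_] := boolP (i \in I2); last by exists set0.
  rewrite !inE => /andP[/forall_inP iI aX].
  have aS : a i \notin S by apply/negP=> /iI; rewrite cla eqxx.
  by have [G GP] := gM i S X xX clX aS aX; exists G.
have [G GP] := fin_all_exists exG.
have exr i : exists r, i \in ~: I -> (r \in S) /\ (cl r = Some i).
  have [|_] := boolP (i \in ~: I); last by exists (a i).
  by rewrite !inE negb_forall_in => /exists_inP[s sS /negPn/eqP cls]; exists s.
have [r rP] := fin_all_exists exr; pose R := [set r i | i in ~: I].
have RS : R \subset S by apply/subsetP=> s /imsetP[i iI ->]; case: (rP i iI).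
have cR : #|R| + #|I| = k.
  have -> : #|R| = #|~: I|.
    apply: card_in_imset => i j /rP[_ ci] /rP[_ cj] rij.
    by move: ci; rewrite rij cj => -[].
  by rewrite addnC cardsC card_ord.
have le2 i : i \in I2 -> 2 <= #|G i :\: R|.
  move=> iI; have [_ c3 mono] := GP i iI.
  have : #|G i :&: R| <= 1.
    apply/card_le1_eqP=> y z; rewrite !inE => /andP[yG /imsetP[j jI yE]] /andP[zG /imsetP[l lI zE]].
    have := mono _ _ yG zG; rewrite yE zE (rP j jI).2 (rP l lI).2 => -[->] //.
  have arith (c d : nat) : c + d = 3 -> c <= 1 -> 2 <= d by clear; lia.
  by apply: arith; rewrite -[RHS]c3 cardsID.
have : \sum_(i in I2) #|G i :\: R| <= #|S :\: R|.
  apply: sum_card_disjoint => [i /GP[GS _ _]|i j /GP[Gi _ _] /GP[Gj _ _] ij].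
    by apply: setSD; apply: subset_trans GS (subsetIl _ _).
  apply: disjointWl (subset_trans (subsetDl _ _) (subset_trans Gi (subsetIr _ _))) _.
  apply: disjointWr (subset_trans (subsetDl _ _) (subset_trans Gj (subsetIr _ _))) _.
  exact: disj.
have -> : 2 * #|I2| = \sum_(i in I2) 2 by rewrite sum_nat_const mulnC.
have le : \sum_(i in I2) 2 <= \sum_(i in I2) #|G i :\: R| by apply: leq_sum.
move/(leq_trans le).
rewrite cardsD (setIidPr RS); have := subset_leq_card RS; move: cR Sk.
have arith (u v w q : nat) : u + v = k -> w < k -> u <= w -> q <= w - u -> q < v.
  by clear; lia.
exact: arith.
Qed.

(** * Large tournaments *)

Lemma strongly_k_connected_conv (V : finType) (t : rel V) k :
  strongly_k_connected t k -> strongly_k_connected (conv t) k.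
Proof.
case=> kV conn; split=> // S cS u v uS vS; have := conn S cS v u vS uS.
rewrite -[connect _ u v]connect_rev; congr is_true; apply: eq_connect => x y /=.
by rewrite /del_rel /conv; congr (_ && _); rewrite andbC.
Qed.

Lemma card_nbr_ge (V : finType) (t : rel V) k (X : {set V}) :
  strongly_k_connected t k -> 0 < k -> X != set0 -> k <= #|~: X| ->
  k <= #|nbr (arcs_of t) X|.
Proof.
case=> _ conn k0 /set0Pn[x xX] cX; rewrite leqNgt; apply/negP=> lt.
set S := nbr _ X in lt; have cS : #|S| <= k.-1 by rewrite -ltnS prednK.
have /subsetPn[y] : ~~ (~: X \subset S).
  by apply: contraL lt => /subset_leq_card/(leq_trans cX); rewrite -leqNgt.
rewrite inE => yX yS; have xS : x \notin S by rewrite inE xX.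
suff : y \in X by rewrite (negbTE yX).
apply: (connect_ind_l (P := fun z => z \in X)) xX _ (conn S cS x y xS yS).
move=> u v _ /and3P[uv _ vS] uX; apply: contraR vS => vX.
by rewrite inE vX; apply/exists_inP; exists u; rewrite // inE.
Qed.

Lemma fans_exist (V : finType) (t : rel V) k (cl : V -> option 'I_k) (A Q : {set V})
    (a : 'I_k -> V) :
  is_tournament t -> lowest (fun v => #|outN t v|) A -> #|A| = k ->
  (forall i, a i \in A) -> (forall i, cl (a i) = Some i) ->
  (forall x, x \in Q -> 43 * k <= #|outN t x|) ->
  exists H : {set V * V},
    [/\ H \subset arcs_of t, #|H| <= #|Q| * (24 * k) &
        forall (S X : {set V}) x, #|S| < k -> x \in X -> x \in Q -> closed_minus S H X ->
          2 * #|[set i in unblocked cl S | a i \notin X]| < #|unblocked cl S|].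
Proof.
move=> tt lA cA aA cla dQ.
have ex x : exists H : {set V * V}, x \in Q -> [/\ H \subset arcs_of t, #|H| <= 24 * k &
    forall S X : {set V}, #|S| < k -> x \in X -> closed_minus S H X ->
      2 * #|[set i in unblocked cl S | a i \notin X]| < #|unblocked cl S|].
  have [xQ|] := boolP (x \in Q); last by exists set0.
  have [M [H [Ht cH disj gM]]] := fan_exists cl tt lA cA aA (dQ x xQ).
  by exists H => _; split=> // S X; apply: fan_majority cla disj gM.
have [h hP] := fin_all_exists ex; exists (\bigcup_(x in Q) h x); split.
- by apply/bigcupsP=> x /hP[].
- rewrite -sum_nat_const; apply: leq_trans (card_bigcup_le _ _) _.
  by apply: leq_sum => x /hP[].
- move=> S X x cS xX xQ clX; have [_ _ hx] := hP x xQ; apply: hx cS xX _.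
  by apply: closed_minus_sub clX; apply: bigcup_sup xQ.
Qed.

(** [v] dominates all of [S] by arcs outside [p], so a vertex of [S] later on the path would give a
    shortcut; the path thus runs from [v] to [b i] without meeting [S]. *)
Lemma linkage_follow (V : finType) (t : rel V) k (a b : 'I_k -> V) cl p (S X : {set V}) v i :
  linkage t a b cl p -> cl v = Some i -> v \in X -> closed_minus S p X ->
  (forall s, s \in S -> t v s /\ (v, s) \notin p) -> b i \in X.
Proof.
move=> Lk cv vX clX vS; have [_ vb] := linkage_path Lk cv.
apply: (connect_ind_l (P := fun z => z \in X)) vX _ vb => u w vu uw uX.
apply: clX uX (uw) _; apply/negP=> /vS[tvw /negP[]].
by apply: (linkage_short Lk) tvw; apply: connect_trans vu (connect1 uw).
Qed.

Definition forward_to (V : finType) (rk : V -> nat) (W : {set V}) (D : {set V * V}) :=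
  forall x y, (x, y) \in D -> y \in W /\ rk x < rk y.

Lemma forward_last (V : finType) (rk : V -> nat) (W S X : {set V}) (D : {set V * V}) v0 :
  forward_to rk W D -> closed_minus S D X -> v0 \in X -> v0 \in W ->
  exists v, [/\ v \in X, v \in W & outs D v \subset S].
Proof.
move=> fwD clX v0X v0W; have v0P : (v0 \in X) && (v0 \in W) by rewrite v0X.
case: (arg_maxnP (P := fun v => (v \in X) && (v \in W)) rk v0P) => v /andP[vX vW] maxv.
exists v; split=> //; apply/subsetP=> w; rewrite inE => vw; have [wW lt] := fwD _ _ vw.
apply: contraTT lt => wS; rewrite -leqNgt; apply: maxv.
by rewrite wW (clX _ _ vX vw wS).
Qed.

(** [X] cannot stay inside [Lw], where it would have [k] neighbours, all in [S]. Its last vertex in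
    [V1] or in [W] has all its forward out-neighbours in [S]. On [V1] this puts it in [Q1]; on [W],
    outside [Q2], the out-neighbours are exactly [S], and the path leads on to some [b i]. *)
Lemma source_reached (V : finType) (t : rel V) k (a b : 'I_k -> V) cl p
    (Lw V1 W Q1 Q2 S X : {set V}) (M D1 D2 : {set V * V}) rk1 rk2 :
  linkage t a b cl p ->
  (forall v, [|| v \in Lw, v \in V1 | v \in W]) ->
  (forall v, v \in W -> cl v != None) ->
  (forall Y : {set V}, Y \subset Lw -> Y != set0 -> k <= #|nbr M Y|) ->
  forward_to rk1 V1 D1 -> (forall x, x \in V1 -> x \notin Q1 -> k <= #|outs D1 x|) ->
  forward_to rk2 W D2 -> (forall x, x \in W -> x \notin Q2 -> k.-1 <= #|outs D2 x|) ->
  (forall x y, (x, y) \in D2 -> t x y /\ (x, y) \notin p) ->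
  #|S| < k -> X != set0 ->
  closed_minus S M X -> closed_minus S D1 X -> closed_minus S D2 X -> closed_minus S p X ->
  exists2 x, x \in X & [\/ x \in Q1, x \in Q2 | exists i, x = b i].
Proof.
move=> Lk cov clW escM f1 d1 f2 d2 D2t cS X0 clM cl1 cl2 clp.
have [v vX vL] : exists2 v, v \in X & v \notin Lw.
  apply/subsetPn/negP=> XL; have := escM X XL X0; rewrite leqNgt => /negP[].
  apply: leq_ltn_trans cS; apply: subset_leq_card; apply/subsetP=> y.
  rewrite inE => /andP[yX /exists_inP[x xX xy]].
  by apply: contraR yX => yS; apply: clM xX xy yS.
have := cov v; rewrite (negbTE vL) /= => /orP[vV1|vW].
  have [u [uX uV1 uS]] := forward_last f1 cl1 vX vV1.
  exists u => //; apply: Or31; apply: contraLR (subset_leq_card uS) => uQ.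
  by rewrite -ltnNge; apply: leq_trans cS (d1 u uV1 uQ).
have [u [uX uW uS]] := forward_last f2 cl2 vX vW.
have [uQ|uQ] := boolP (u \in Q2); first by exists u => //; apply: Or32.
have uSE : outs D2 u = S.
  apply/eqP; rewrite eqEcard uS; apply: leq_trans (d2 u uW uQ).
  by rewrite -ltnS (ltn_predK cS).
case E: (cl u) (clW u uW) => [i|] // _; exists (b i); last by apply: Or33; exists i.
apply: linkage_follow Lk E uX clp _ => s; rewrite -uSE inE => /D2t; exact.
Qed.

Lemma forward_transp (V : finType) (rk : V -> nat) (W : {set V}) (D : {set V * V}) :
  (forall x y, (x, y) \in D -> x \in W /\ rk x < rk y) ->
  exists rk', forward_to rk' W (transp D).
Proof.
move=> fw; exists (fun x => \max_y rk y - rk x) => x y; rewrite in_transp => /fw[xW lt].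
by split=> //; apply: ltn_sub2l => //; apply: leq_trans lt (leq_bigmax _).
Qed.

(** Two majorities of the paths avoiding [S] share a member: its start is reached from [u], its end
    leads to [v], and it survives the deletion. *)
Lemma strongly_connected_majority (V : finType) (t : rel V) k (a b : 'I_k -> V) cl p
    (D : {set V * V}) (S : {set V}) :
  linkage t a b cl p -> p \subset D ->
  (forall X : {set V}, X != set0 -> closed_minus S D X ->
     2 * #|[set i in unblocked cl S | a i \notin X]| < #|unblocked cl S|) ->
  (forall X : {set V}, X != set0 -> closed_minus S (transp D) X ->
     2 * #|[set i in unblocked cl S | b i \notin X]| < #|unblocked cl S|) ->
  strongly_connected_minus (arel D) S.
Proof.
move=> Lk pD outX inX u v uS vS; set e := del_rel _ S.
pose X := [set x | (x \notin S) && connect e u x].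
pose Y := [set y | (y \notin S) && connect e y v].
have ltX := outX X _ _; have ltY := inX Y _ _.
have {}ltX : 2 * #|[set i in unblocked cl S | a i \notin X]| < #|unblocked cl S|.
  apply: ltX; first by apply/set0Pn; exists u; rewrite inE uS connect0.
  move=> x y; rewrite !inE => /andP[xS ux] xy yS; rewrite yS /=.
  by apply: connect_trans ux (connect1 _); rewrite /e /del_rel /arel xy xS.
have {}ltY : 2 * #|[set i in unblocked cl S | b i \notin Y]| < #|unblocked cl S|.
  apply: ltY; first by apply/set0Pn; exists v; rewrite inE vS connect0.
  move=> x y; rewrite in_transp !inE => /andP[xS xv] yx yS; rewrite yS /=.
  by apply: connect_trans (connect1 _) xv; rewrite /e /del_rel /arel yx yS.
have [i iI [iX iY]] : exists2 i, i \in unblocked cl S & a i \in X /\ b i \in Y.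
  have /subsetPn[i iI] : ~~ (unblocked cl S \subset
      [set i in unblocked cl S | a i \notin X] :|: [set i in unblocked cl S | b i \notin Y]).
    apply/negP=> /subset_leq_card le.
    have := leq_trans le (leq_card_setU _ _).1; move: ltX ltY.
    have arith (c d n : nat) : 2 * c < n -> 2 * d < n -> n <= c + d -> False.
      by clear; lia.
    exact: arith.
  rewrite in_setU negb_or => /andP[n1 n2]; exists i => //.
  by split; [apply: contraR n1|apply: contraR n2] => n; rewrite in_set; apply/andP.
move: iI; rewrite inE => /forall_inP iS.
have NS z : cl z = Some i -> z \notin S.
  by move=> cz; apply/negP=> /iS; rewrite cz eqxx.
have [_ ab] := linkage_path Lk (linkage_start Lk i).
have eab : connect e (a i) (b i).
  pose P z := cl z = Some i /\ connect e (a i) z.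
  suff : P (b i) by case.
  apply: (connect_ind_l (P := P)) ab => [|x y _ xy [cx ax]].
    by split; [exact: (linkage_start Lk)|exact: connect0].
  have cy : cl y = Some i by rewrite -(linkage_cl Lk xy).
  split=> //; apply: connect_trans ax (connect1 _).
  by rewrite /e /del_rel /arel (subsetP pD _ xy) !NS.
move: iX iY; rewrite !inE => /andP[_ ua] /andP[_ bv].
exact: connect_trans ua (connect_trans eab bv).
Qed.

(** [E] consists of arcs escaping from [Lw] and of fans at all possible exits [Q1], [Q2] and [B].
    The hypotheses are arranged to fit both [t] and, with [A] and [B] exchanged, [conv t]. *)
Lemma majority_reached (V : finType) (t : rel V) k (A B : {set V}) (a b : 'I_k -> V) cl p
    (Lw V1 W Q1 Q2 : {set V}) (D1 D2 : {set V * V}) rk1 rk2 :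
  is_tournament t -> strongly_k_connected t k -> 0 < k ->
  lowest (fun v => #|outN t v|) A -> #|A| = k -> (forall i, a i \in A) ->
  (forall i, b i \in B) -> (forall v, v \in B -> 43 * k <= #|outN t v|) ->
  linkage t a b cl p ->
  (forall v, v \notin Lw -> 43 * k <= #|outN t v|) -> k <= #|~: Lw| ->
  (forall v, [|| v \in Lw, v \in V1 | v \in W]) ->
  (forall v, v \in V1 -> v \notin Lw) -> (forall v, v \in W -> v \notin Lw) ->
  (forall v, v \in W -> cl v != None) ->
  Q1 \subset V1 -> Q2 \subset W ->
  forward_to rk1 V1 D1 -> (forall x, x \in V1 -> x \notin Q1 -> k <= #|outs D1 x|) ->
  forward_to rk2 W D2 -> (forall x, x \in W -> x \notin Q2 -> k.-1 <= #|outs D2 x|) ->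
  (forall x y, (x, y) \in D2 -> t x y /\ (x, y) \notin p) ->
  exists E : {set V * V},
    [/\ E \subset arcs_of t,
        #|E| <= k * #|Lw| + #|Q1 :|: Q2 :|: B| * (24 * k) &
        forall S X : {set V}, #|S| < k -> X != set0 ->
          closed_minus S E X -> closed_minus S D1 X -> closed_minus S D2 X ->
          closed_minus S p X ->
          2 * #|[set i in unblocked cl S | a i \notin X]| < #|unblocked cl S|].
Proof.
move=> tt tc k0 lA cA aA bB dB Lk dL cL cov nV1 nW clW /subsetP QV /subsetP QW f1 d1 f2 d2 D2t.
have dQ x : x \in Q1 :|: Q2 :|: B -> 43 * k <= #|outN t x|.
  rewrite !inE -orbA => /or3P[/QV/nV1/dL //|/QW/nW/dL //|]; exact: dB.
have [H [Ht cH maj]] := fans_exist tt lA cA aA (linkage_start Lk) dQ.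
have esc (X : {set V}) : X \subset Lw -> X != set0 -> k <= #|nbr (arcs_of t) X|.
  move=> XL X0; apply: card_nbr_ge => //; apply: leq_trans cL _.
  by apply: subset_leq_card; rewrite setCS.
have [M [Mt cM escM]] := sparse_escape esc.
exists (M :|: H); split; first by rewrite subUset Mt.
  by apply: leq_trans (leq_card_setU _ _).1 _; apply: leq_add.
move=> S X cS X0 clE cl1 cl2 clp.
have clM := closed_minus_sub (subsetUl M H) clE.
have [x xX xQ] := source_reached Lk cov clW escM f1 d1 f2 d2 D2t cS X0 clM cl1 cl2 clp.
apply: maj cS xX _ (closed_minus_sub (subsetUr M H) clE).
by rewrite !inE; case: xQ => [->|->|[i ->]]; rewrite ?bB ?orbT.
Qed.

(** [w], [l], [v] stand for the sizes of [W], [Lw], [V1], and [y] for the number of path arcs. On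
    [W], [k - 1] forward arcs and a path arc make [k] per vertex. The excess, in multiples of
    [k * k], is at most 172 from the second [k * l], 240 from the fans, 172 from path arcs at [Lw]
    and 13 from the two squares: 597 in all. *)
Lemma large_count (k w l v q q' e e' x1 x2 y d : nat) :
  0 < k -> e <= k * l + q * (24 * k) -> e' <= k * l + q' * (24 * k) ->
  x1 <= k * v + (k + 2) * (k + 2) -> x2 <= k.-1 * w + (k.-1 + 2) * (k.-1 + 2) ->
  y <= w + l -> l <= 172 * k -> q <= 5 * k -> q' <= 5 * k -> d <= e + e' + x1 + x2 + y ->
  d <= k * (w + l + v) + 600 * (k * k).
Proof.
case: k => // k _ /= he he' h1 h2 hy hl hq hq'.
have := leq_mul (leqnn k.+1) hl; have := leq_mul hq (leqnn k.+1).
by have := leq_mul hq' (leqnn k.+1); lia.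
Qed.

Lemma large_tournament (V : finType) (t : rel V) k :
  is_tournament t -> strongly_k_connected t k -> 0 < k -> 173 * k <= #|V| ->
  exists D : {set V * V},
    [/\ D \subset arcs_of t, #|D| <= k * #|V| + 600 * (k * k) &
        forall S : {set V}, #|S| < k -> strongly_connected_minus (arel D) S].
Proof.
move=> tt tc k0 big; have ct := tournament_conv tt.
have ctc := strongly_k_connected_conv tc.
have kV : k <= #|V| by case: tc => /ltnW.
have [A cA lA] := lowest_exists (fun v => #|outN t v|) kV.
have [B cB lB] := lowest_exists (fun v => #|outN (conv t) v|) kV.
have [a [b [cl [p [Lk AE BE]]]]] := linkage_exists tt tc k0 cA cB.
have aA i : a i \in A by apply/AE; exists i.
have bB i : b i \in B by apply/BE; exists i.
(* At most [86 * k] vertices have out-degree below [43 * k], and likewise for in-degree; [173 * k]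
   vertices therefore leave [k] outside [Lw]. *)
pose Lw := [set v | #|outN t v| < 43 * k] :|: [set v | #|outN (conv t) v| < 43 * k].
have cL : #|Lw| <= 172 * k.
  apply: leq_trans (leq_card_setU _ _).1 _.
  have := leq_add (card_low_outN (43 * k) tt) (card_low_outN (43 * k) ct).
  by rewrite !mulnA -mulnDl.
have cNL : k <= #|~: Lw|.
  have := cardsC Lw; move: #|Lw| #|~: Lw| cL => x y.
  by move: #|V| big; clear; lia.
have dL v : v \notin Lw -> 43 * k <= #|outN t v|.
  by rewrite !inE negb_or -!leqNgt => /andP[].
have dL' v : v \notin Lw -> 43 * k <= #|outN (conv t) v|.
  by rewrite !inE negb_or -!leqNgt => /andP[].
have arithB n d : 173 * k <= n -> n <= 2 * d + k -> 43 * k <= d by clear; lia.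
have dB v : v \in B -> 43 * k <= #|outN t v|.
  by move=> vB; apply: arithB big _; rewrite -cB; apply: lowest_conv_outN lB vB.
have dA v : v \in A -> 43 * k <= #|outN (conv t) v|.
  move=> vA; apply: arithB big _; rewrite -cA.
  exact: (@lowest_conv_outN _ (conv t) A v ct lA vA).
pose U := [set v | cl v != None]; pose W := U :\: Lw; pose V1 := ~: (U :|: Lw).
have pout x y z : arel p x y -> arel p x z -> y = z := @linkage_out _ _ _ _ _ _ _ Lk x y z.
have pin x y z : arel p y x -> arel p z x -> y = z := @linkage_in _ _ _ _ _ _ _ Lk x y z.
have [D1 [rk1 [Q1 [Q1' [D1P cD1 [Q1V cQ1 d1] [Q1V' cQ1' d1']]]]]] :=
  sparse_forward V1 k tt pout pin.
(* On the paths [k.-1] forward arcs suffice, since the path arc is added anyway. *)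
have [D2 [rk2 [Q2 [Q2' [D2P cD2 [Q2W cQ2 d2] [Q2W' cQ2' d2']]]]]] :=
  sparse_forward W k.-1 tt pout pin.
have f1 : forward_to rk1 V1 D1 by move=> x y /D1P[].
have f2 : forward_to rk2 W D2 by move=> x y /D2P[].
have [rk1' f1'] : exists rk', forward_to rk' V1 (transp D1).
  by apply: (@forward_transp _ rk1) => x y /D1P[].
have [rk2' f2'] : exists rk', forward_to rk' W (transp D2).
  by apply: (@forward_transp _ rk2) => x y /D2P[].
have cov v : [|| v \in Lw, v \in V1 | v \in W].
  by rewrite !in_setD !in_setC in_setU; case: (v \in Lw); case: (v \in U).
have nV1 v : v \in V1 -> v \notin Lw by rewrite in_setC in_setU negb_or => /andP[].
have nW v : v \in W -> v \notin Lw by rewrite in_setD => /andP[].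
have clW v : v \in W -> cl v != None by rewrite in_setD => /andP[_]; rewrite inE.
have D2t x y : (x, y) \in D2 -> t x y /\ (x, y) \notin p by move=> /D2P[].
have D2t' x y : (x, y) \in transp D2 -> conv t x y /\ (x, y) \notin transp p.
  by rewrite !in_transp => /D2t.
have d1T x : x \in V1 -> x \notin Q1' -> k <= #|outs (transp D1) x|.
  by rewrite outs_transp; apply: d1'.
have d2T x : x \in W -> x \notin Q2' -> k.-1 <= #|outs (transp D2) x|.
  by rewrite outs_transp; apply: d2'.
have [E [Et cE maj]] := majority_reached tt tc k0 lA cA aA bB dB Lk dL cNL cov nV1 nW clW
  Q1V Q2W f1 d1 f2 d2 D2t.
have [E' [Et' cE' maj']] := majority_reached ct ctc k0 lB cB bB aA dA (linkage_transp Lk)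
  dL' cNL cov nV1 nW clW Q1V' Q2W' f1' d1T f2' d2T D2t'.
pose D := E :|: transp E' :|: D1 :|: D2 :|: p; exists D; split.
- apply/subsetP=> -[x y]; rewrite !in_setU in_transp => h.
  rewrite inE /=; case/orP: h => [|/(linkage_sub Lk) //].
  case/orP=> [|/D2P[] //]; case/orP=> [|/D1P[] //].
  by case/orP=> [/(subsetP Et)|/(subsetP Et')]; rewrite inE.
- have cQ (Z Z' Z'' : {set V}) : #|Z| <= 2 * k + 1 -> #|Z'| <= 2 * k.-1 + 1 -> #|Z''| = k ->
      #|Z :|: Z' :|: Z''| <= 5 * k.
    move=> cZ cZ' cZ''; apply: leq_trans (leq_card_setU _ _).1 _; rewrite cZ''.
    have := (leq_card_setU Z Z').1; move: cZ cZ' k0.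
    by move: #|_| #|_| #|_|; clear; lia.
  have cp : #|p| <= #|W| + #|Lw|.
    rewrite -card_outs_sum; have cU : #|U| <= #|W| + #|Lw|.
      by rewrite -(cardsID Lw U) addnC leq_add2l subset_leq_card ?subsetIr.
    apply: leq_trans cU; rewrite card_set_sum; apply: leq_sum => x _.
    case: (boolP (x \in U)) => xU /=.
      by apply/card_le1_eqP=> y z; rewrite !inE => xy xz; apply: (linkage_out Lk xz xy).
    rewrite leqn0 cards_eq0; apply/eqP/setP=> y; rewrite !inE.
    by apply: contraNF xU => /(linkage_dom Lk); rewrite inE.
  have cV : #|W| + #|Lw| + #|V1| = #|V|.
    rewrite -(cardsC (U :|: Lw)) -/V1; congr addn.
    by rewrite -(cardsID Lw (U :|: Lw)) setIUl setIid setDUl setDv setU0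
      (setUidPr (subsetIr _ _)) addnC.
  have cD := leq_card_setU.
  have cDE : #|D| <= #|E| + #|E'| + #|D1| + #|D2| + #|p|.
    apply: leq_trans (cD _ _ _).1 _; rewrite leq_add2r.
    apply: leq_trans (cD _ _ _).1 _; rewrite leq_add2r.
    apply: leq_trans (cD _ _ _).1 _; rewrite leq_add2r.
    by apply: leq_trans (cD _ _ _).1 _; rewrite card_transp.
  move: (cQ _ _ _ cQ1' cQ2' cA); move: (cQ _ _ _ cQ1 cQ2 cB).
  by rewrite -cV => h1 h2; apply: large_count k0 cE cE' cD1 cD2 cp cL h1 h2 cDE.
- move=> S cS; apply: (strongly_connected_majority Lk); first exact: subsetUr.
    move=> X X0 clX; apply: maj cS X0 _ _ _ _; apply: closed_minus_sub clX;
      by apply/subsetP=> e eE; rewrite !in_setU eE ?orbT.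
  move=> X X0 clX; apply: maj' cS X0 _ _ _ _; apply: closed_minus_sub clX;
    by apply/subsetP=> -[x y] eE; move: (eE); rewrite !in_transp !in_setU ?in_transp => ->;
       rewrite ?orbT.
Qed.

(** * Tournaments of moderate order *)

(** A greedy matching of [m] arcs: each vertex of [K] or [L] spoils at most one of them. Removing
    the ends of a chosen arc lowers the remaining degrees by at most one. *)
Lemma robust_matching (V : finType) (t : rel V) m (Z Y : {set V}) :
  m <= #|Z| -> (forall z, z \in Z -> m <= #|outN t z :&: Y|) ->
  exists N : {set V * V},
    [/\ #|N| <= m,
        forall z y, (z, y) \in N -> [/\ t z y, z \in Z & y \in Y] &
        forall K L : {set V}, #|K| + #|L| < m ->
          exists z y, [/\ (z, y) \in N, z \notin K & y \notin L]].
Proof.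
elim: m Z Y => [|m IH] Z Y cZ dZ.
  by exists set0; rewrite cards0; split=> // z y; rewrite inE.
have /set0Pn[z zZ] : Z != set0 by rewrite -card_gt0; apply: leq_trans cZ.
have /set0Pn[y] : outN t z :&: Y != set0.
  by rewrite -card_gt0; apply: leq_trans (dZ z zZ).
rewrite !inE => /andP[zy yY].
have [||N [cN NP robust]] := IH (Z :\ z) (Y :\ y).
- by move: cZ; rewrite (cardsD1 z Z) zZ.
- move=> u; rewrite inE => /andP[_ uZ]; rewrite setIDA.
  have := dZ u uZ; rewrite (cardsD1 y); case: (y \in _) => //=.
  by rewrite add0n => /ltnW.
exists ((z, y) |: N); split.
- by rewrite cardsU1; case: (_ \notin _); rewrite //= ?add0n ?(leqW cN).
- move=> u v; rewrite !inE => /predU1P[[-> ->] //|/NP[uv]].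
  by rewrite !inE => /andP[_ uZ] /andP[_ vY].
move=> K L small; have [zK|zK] := boolP (z \in K).
  have [|u [v [uv uK vL]]] := robust (K :\ z) L.
    by move: small; rewrite (cardsD1 z K) zK.
  exists u, v; split=> //; first by rewrite inE uv orbT.
  have [_ + _] := NP _ _ uv; rewrite inE => /andP[uz _].
  by move: uK; rewrite !inE; move: uz; rewrite inE => ->.
have [yL|yL] := boolP (y \in L).
  have [|u [v [uv uK vL]]] := robust K (L :\ y).
    by move: small; rewrite (cardsD1 y L) yL addnCA.
  exists u, v; split=> //; first by rewrite inE uv orbT.
  have [_ _] := NP _ _ uv; rewrite inE => /andP[vy _].
  by move: vL; rewrite !inE; move: vy; rewrite inE => ->.
by exists z, y; rewrite !inE eqxx.
Qed.

(** All arcs out of [B] and into [A] are kept, and sparse escapes let [u] reach some [b] in [B] and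
    let some [a] in [A] reach [v]. If [a] were not reached, all but few out-neighbours of [a] and
    [b] would be common, and a surviving arc of the matching from [outN t a] to its complement would
    still lead on to [a]. *)
Lemma middle_tournament (V : finType) (t : rel V) k :
  is_tournament t -> strongly_k_connected t k -> 0 < k -> 23 * k <= #|V| ->
  exists D : {set V * V},
    [/\ D \subset arcs_of t, #|D| <= 4 * (k * #|V|) + 3 * (k * k) &
        forall S : {set V}, #|S| < k -> strongly_connected_minus (arel D) S].
Proof.
move=> tt tc k0 big; have ct := tournament_conv tt.
have ctc := strongly_k_connected_conv tc.
have kV : k <= #|V| by case: tc => /ltnW.
have [A cA lA] := lowest_exists (fun v => #|outN t v|) kV.
have [B cB lB] := lowest_exists (fun v => #|outN (conv t) v|) kV.
have esc (t' : rel V) (C : {set V}) : strongly_k_connected t' k -> #|C| = k ->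
    forall X : {set V}, X \subset ~: C -> X != set0 -> k <= #|nbr (arcs_of t') X|.
  move=> tc' cC X XC X0; apply: card_nbr_ge => //; rewrite -cC.
  by apply: subset_leq_card; rewrite -setCS setCK.
have [M [Mt cM escM]] := sparse_escape (esc t B tc cB).
have [M' [Mt' cM' escM']] := sparse_escape (esc (conv t) A ctc cA).
have exN a : exists N : {set V * V}, a \in A -> 10 * k <= #|outN t a| ->
    [/\ #|N| <= 3 * k,
        forall z y, (z, y) \in N -> [/\ t z y, z \in outN t a & y \notin outN t a] &
        forall K L : {set V}, #|K| + #|L| < 3 * k ->
          exists z y, [/\ (z, y) \in N, z \notin K & y \notin L]].
  have [/andP[aA da]|no] := boolP ((a \in A) && (10 * k <= #|outN t a|)); last first.
    by exists set0 => aA da; rewrite aA da in no.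
  have [||N [cN NP robust]] :=
      @robust_matching _ t (3 * k) (outN t a :\: bad t a (3 * k)) (~: outN t a).
  - rewrite cardsD; have := card_bad (3 * k) tt lA aA; rewrite cA.
    have := subset_leq_card (subsetIr (outN t a) (bad t a (3 * k))).
    have arith (d e f : nat) : 10 * k <= d -> e <= f -> f <= 2 * (3 * k) + k ->
      3 * k <= d - e by clear; lia.
    exact: arith da.
  - move=> z; rewrite !inE => /andP[+ az].
    by rewrite az /= -leqNgt => /leq_trans-> //; rewrite setDE.
  exists N => _ _; split=> // z y /NP[zy].
  by rewrite in_setD in_setC => /andP[_ za] ya; split.
have [N NP] := fin_all_exists exN.
pose OB := [set q : V * V | (q.1 \in B) && t q.1 q.2].
pose IA := [set q : V * V | (q.2 \in A) && t q.1 q.2].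
pose NA := \bigcup_(a in A | 10 * k <= #|outN t a|) N a.
pose D := M :|: transp M' :|: OB :|: IA :|: NA; exists D; split.
- rewrite !subUset; do !(apply/andP; split); rewrite ?Mt //.
  + by apply/subsetP=> -[x y]; rewrite in_transp => /(subsetP Mt'); rewrite !inE.
  + by apply/subsetP=> -[x y]; rewrite !inE => /andP[].
  + by apply/subsetP=> -[x y]; rewrite !inE => /andP[].
  + apply/bigcupsP=> a /andP[aA da]; have [_ Nt _] := NP a aA da.
    by apply/subsetP=> -[x y] /Nt[txy _ _]; rewrite inE.
- have cC (C : {set V}) : k * #|C| <= k * #|V| by rewrite leq_mul2l max_card orbT.
  have cOB : #|OB| <= k * #|V|.
    rewrite -cB -cardsT -cardsX; apply: subset_leq_card; apply/subsetP=> -[x y].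
    by rewrite !inE => /andP[->].
  have cIA : #|IA| <= k * #|V|.
    rewrite -cA -cardsT mulnC -cardsX; apply: subset_leq_card; apply/subsetP=> -[x y].
    by rewrite !inE => /andP[->].
  have cNA : #|NA| <= 3 * (k * k).
    apply: leq_trans (card_bigcup_le _ _) _.
    apply: (@leq_trans (\sum_(a in A | 10 * k <= #|outN t a|) 3 * k)).
      by apply: leq_sum => a /andP[aA da]; have [] := NP a aA da.
    rewrite sum_nat_const mulnCA leq_mul2l; apply/orP; right.
    rewrite leq_mul2r; apply/orP; right; rewrite -cA; apply: subset_leq_card.
    by apply/subsetP=> a /andP[].
  have cU := leq_card_setU.
  have cDE : #|D| <= #|M| + #|M'| + #|OB| + #|IA| + #|NA|.
    apply: leq_trans (cU _ _ _).1 _; rewrite leq_add2r.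
    apply: leq_trans (cU _ _ _).1 _; rewrite leq_add2r.
    apply: leq_trans (cU _ _ _).1 _; rewrite leq_add2r.
    by apply: leq_trans (cU _ _ _).1 _; rewrite card_transp.
  have arith (d m m' o i n c e : nat) : d <= m + m' + o + i + n -> m <= c -> m' <= c ->
    o <= c -> i <= c -> n <= e -> d <= 4 * c + e by clear; lia.
  exact: arith cDE (leq_trans cM (cC _)) (leq_trans cM' (cC _)) cOB cIA cNA.
move=> S cS u v uS vS; set e := del_rel _ S.
pose X := [set x | (x \notin S) && connect e u x].
pose Y := [set y | (y \notin S) && connect e y v].
have clX : closed_minus S D X.
  move=> x y; rewrite !inE => /andP[xS ux] xy yS; rewrite yS /=.
  by apply: connect_trans ux (connect1 _); rewrite /e /del_rel /arel !inE xy xS.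
have clY : closed_minus S (transp D) Y.
  move=> x y; rewrite in_transp [x \in Y]inE [y \in Y]inE => /andP[xS xv] yx yS; rewrite yS /=.
  by apply: connect_trans (connect1 _) xv; rewrite /e /del_rel /arel yx yS.
have meet (M0 : {set V * V}) (C Z : {set V}) :
    (forall X : {set V}, X \subset ~: C -> X != set0 -> k <= #|nbr M0 X|) ->
    closed_minus S M0 Z -> Z != set0 -> exists2 c, c \in C & c \in Z.
  move=> esc0 clZ Z0; have /subsetPn[c cZ] : ~~ (Z \subset ~: C).
    apply/negP=> ZC; have := esc0 Z ZC Z0; rewrite leqNgt => /negP[].
    apply: leq_ltn_trans cS; apply: subset_leq_card; apply/subsetP=> y.
    rewrite inE => /andP[yZ /exists_inP[x xZ xy]].
    by apply: contraR yZ => yS; apply: clZ xZ xy yS.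
  by rewrite inE negbK => cC; exists c.
have [b bB bX] : exists2 b, b \in B & b \in X.
  apply: meet escM _ _; last by apply/set0Pn; exists u; rewrite inE uS connect0.
  by apply: closed_minus_sub clX; apply/subsetP=> x xM; rewrite !in_setU xM.
have [a aA aY] : exists2 a, a \in A & a \in Y.
  apply: meet escM' _ _; last by apply/set0Pn; exists v; rewrite inE vS connect0.
  apply: closed_minus_sub clY; apply/subsetP=> -[x y] xM.
  by rewrite in_transp !in_setU in_transp xM orbT.
have [aS av] : a \notin S /\ connect e a v by move: aY; rewrite inE => /andP[].
suff : a \in X by rewrite inE => /andP[_ ua]; apply: connect_trans ua av.
apply: contraT => aX.
have toA y : y \in X -> ~~ t y a.
  move=> yX; apply: contra aX => ya; apply: clX yX _ aS.
  by rewrite !in_setU [(y, a) \in IA]inE /= aA ya ?orbT.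
have fromB y : t b y -> y \notin S -> y \in X.
  move=> tby; apply: clX bX _; by rewrite !in_setU [(b, y) \in OB]inE /= bB tby ?orbT.
have ba : b != a by apply: contraNneq aX => <-.
have tab : t a b by rewrite (tournamentN tt ba) toA.
(* An undeleted out-neighbour of [b] that [a] does not dominate would itself lead to [a]. *)
have subS : outN t b :\: outN t a \subset S.
  apply/subsetP=> y; rewrite !inE => /andP[ay tby].
  apply: contraR ay => yS; rewrite (tournamentN tt) ?toA ?fromB //.
  by apply: contraTneq tby => ->; rewrite (tournament_asym tt tab).
have db := lowest_conv_outN tt lB bB; rewrite cB in db.
have da := @lowest_conv_outN _ (conv t) A a ct lA aA; rewrite cA in da.
have dab := card_outN_conv a tt.
have cI := cardsID (outN t a) (outN t b); have cI' := cardsID (outN t b) (outN t a).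
rewrite setIC in cI'; have cSub := leq_ltn_trans (subset_leq_card subS) cS.
have da10 : 10 * k <= #|outN t a|.
  have arith (n d d' i j j' : nat) : 23 * k <= n -> n <= 2 * d + k -> i + j = d ->
    j < k -> i + j' = d' -> 10 * k <= d' by clear; lia.
  exact: arith big db cI cSub cI'.
have [cN Nt robust] := NP a aA da10.
(* [K] and [L] exclude matching arcs that start outside [outN t b] or meet [S]. Comparing degrees
   gives [#|outN t a :\: outN t b| < 2 * k], so with [#|S| < k] fewer than [3 * k] vertices are
   excluded. *)
have [|z [y [zy zK yL]]] := robust ((outN t a :\: outN t b) :|: (S :&: outN t a)) (S :\: outN t a).
  have := cardsID (outN t a) S.
  have := (leq_card_setU (outN t a :\: outN t b) (S :&: outN t a)).1.
  have arith (n d d' e' i j j' s s1 s2 w : nat) : n <= 2 * d + k -> n <= 2 * e' + k ->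
    d' + e' + 1 = n -> i + j = d -> j < k -> i + j' = d' -> s < k ->
    w <= j' + s1 -> s1 + s2 = s -> w + s2 < 3 * k by clear; lia.
  exact: arith db da dab cI cSub cI' cS.
have [tzy za ya] := Nt _ _ zy.
have zX : z \in X.
  move: zK; rewrite in_setU in_setI in_setD za !andbT negb_or negbK.
  by case/andP=> bz zS; apply: fromB => //; move: bz; rewrite inE.
have yS : y \notin S by move: yL; rewrite in_setD ya.
have yX : y \in X.
  apply: clX zX _ yS; rewrite !in_setU; apply/orP; right.
  by apply/bigcupP; exists a; rewrite // aA.
have [yE|yna] := eqVneq y a; first by rewrite -yE yX in aX.
have := toA y yX; move: ya; rewrite inE (tournamentN tt yna).
by case: (t y a).
Qed.

(** * All orders together, and the bound with the logarithm *)

Lemma sparse_spanning (V : finType) (t : rel V) k :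
  is_tournament t -> strongly_k_connected t k -> 0 < k ->
  exists D : {set V * V},
    [/\ D \subset arcs_of t, #|D| <= k * #|V| + 600 * (k * k) &
        forall S : {set V}, #|S| < k -> strongly_connected_minus (arel D) S].
Proof.
move=> tt tc k0.
have [big|small] := leqP (173 * k) #|V|; first exact: large_tournament.
(* With [n] the order, [n < 173 * k] makes [3 * k * n] at most [519 * k^2]; if even [n < 23 * k],
   all [n * n <= 529 * k^2] pairs are affordable. *)
have [mid|smaller] := leqP (23 * k) #|V|.
  have [D [Dt cD sD]] := middle_tournament tt tc k0 mid; exists D; split=> //.
  apply: leq_trans cD _; have := leq_mul (leqnn k) (ltnW small).
  by move: #|V|; clear; lia.
exists (arcs_of t); split=> // [|S cS u v uS vS].
  apply: leq_trans (max_card _) _; rewrite card_prod.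
  by have := leq_mul (ltnW smaller) (ltnW smaller); move: #|V|; clear; lia.
have [_ conn] := tc; have := conn S _ u v uS vS; rewrite -ltnS prednK // => /(_ cS).
apply: connect_sub => x y /and3P[xy xS yS]; apply: connect1.
by rewrite /del_rel /arel inE /= xy xS yS.
Qed.

(** This lets the excess [600 * k^2], obtained without a logarithm, be absorbed by the logarithmic
    term. *)
Lemma log2R_ge1 (k : nat) : 1 <= k -> (1 <= log2R (INR k + 1))%R.
Proof.
move=> /leP/le_INR /= k1; rewrite /log2R; apply: (Rmult_le_reg_r (ln 2)).
  by rewrite -ln_1; apply: ln_increasing; lra.
rewrite /Rdiv Rmult_assoc Rinv_l ?Rmult_1_r ?Rmult_1_l; last first.
  by apply: Rgt_not_eq; rewrite -ln_1; apply: ln_increasing; lra.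
case: (Rle_lt_or_eq_dec 2 (INR k + 1)) => [|lt|<-]; [lra|left|lra].
by apply: ln_increasing; lra.
Qed.

Theorem theorem1p3 (k : nat) (V : finType) (t : rel V) :
  1 <= k ->
  is_tournament t ->
  strongly_k_connected t k ->
  exists d : rel V,
    spanning_subgraph d t /\ strongly_k_connected d k /\
    (INR (num_arcs d) <= INR (k * #|V|) + 750 * INR k ^ 2 * log2R (INR k + 1))%R.
Proof.
move=> k0 tt tc; have [D [Dt cD sD]] := sparse_spanning tt tc k0.
exists (arel D); split; [|split].
- by move=> x y /(subsetP Dt); rewrite inE.
- by split=> [|S cS]; [case: tc|apply: sD; rewrite -(prednK k0)].
have -> : num_arcs (arel D) = #|D| by apply: eq_card => -[x y]; rewrite inE.
move/leP/le_INR: cD; rewrite plus_INR (mult_INR 600) (mult_INR k k) => cD.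
apply: Rle_trans cD _; apply: Rplus_le_compat_l.
have log1 := log2R_ge1 k0; have : (0 <= INR k * INR k)%R by apply: Rle_0_sqr.
have -> : INR 600 = 600%R by rewrite INR_IZR_INZ.
move: (log2R _) log1 => l log1 sq.
apply: (Rle_trans _ (750 * INR k ^ 2 * 1)); first by rewrite /= ; lra.
by apply: Rmult_le_compat_l => //; rewrite /=; lra.
Qed.
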